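(* Let $N\in\mathbb{N}$ and let $\{S_n,\ n=0,1,\ldots\}$ be a discrete-time birth-death chain on the spider $\mathbb{S}_N$ with $N$ legs, with block tridiagonal transition probability matrix $\bm P$ and associated $N\times N$ matrix-valued polynomials $(\bm Q_n)_{n\ge 0}$ (all as defined in the context). Then there exists an $N\times N$ weight matrix $\bm W$ supported on the interval $[-1,1]$ such that the polynomials $(\bm Q_n)_{n\geq 0}$ are orthogonal with respect to $\bm W$, i.e. $$\int_{-1}^1\bm Q_n(x)\,d\bm W(x)\,\bm Q_m^T(x)=\|\bm Q_n\|_{\bm W}^2\,\delta_{nm},\qquad n,m\ge 0,$$ where $\|\bm Q_n\|_{\bm W}^2:=\int_{-1}^1\bm Q_n(x)\,d\bm W(x)\,\bm Q_n^T(x)$ is a nonsingular matrix for every $n\geq 0$.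
   Context: **Birth-death chain on a spider.** For $N\in\mathbb{N}$ let $\mathbb{S}_N=\{v_N(k,m): k\in\mathbb{N}_0,\ m=1,\ldots,N\}$ with $v_N(k,m)=k\exp(2\pi i(m-1)/N)$; the point $v_N(0):=v_N(0,m)$ (the same for all $m$) is the body of the spider and $N$ is the number of legs. A homogeneous discrete-time birth-death chain $\{S_n\}$ on $\mathbb{S}_N$ is a Markov chain with transition probabilities: from $v_N(0)$ to $v_N(0)$ with probability $\alpha_0$ and from $v_N(0)$ to $v_N(1,m)$ with probability $\alpha_m$, $m=1,\ldots,N$, where $\sum_{m=0}^N\alpha_m=1$; and, for $k\ge1$ and $m=1,\ldots,N$, from $v_N(k,m)$ to $v_N(k+1,m)$, $v_N(k,m)$, $v_N(k-1,m)$ with probabilities $a_{k,m}$, $b_{k,m}$, $c_{k,m}$ respectively, where $a_{k,m}+b_{k,m}+c_{k,m}=1$. It is assumed that $\alpha_m>0$ ($m=1,\ldots,N$), $a_{k,m}>0$, $c_{k,m}>0$, and $\alpha_0\ge 0$, $b_{k,m}\geq 0$. **Transition matrix.** Label the states so that $v_N(0)$ is $0$, the points $v_N(1,1),\ldots,v_N(1,N)$ are $1,\ldots,N$, the points $v_N(2,1),\ldots,v_N(2,N)$ are $N+1,\ldots,2N$, and so on. Grouping the states in blocks of $N$ consecutive labels, the transition matrix is $$\bm P=\begin{pmatrix}\bm B_0&\bm A_0&&&\\ \bm C_1&\bm B_1&\bm A_1&&\\ &\bm C_2&\bm B_2&\bm A_2&\\ &&\ddots&\ddots&\ddots\end{pmatrix},$$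 where $$\bm B_0=\begin{pmatrix}\alpha_0&\alpha_1&\alpha_2&\cdots&\alpha_{N-1}\\ c_{1,1}&b_{1,1}&0&\cdots&0\\ c_{1,2}&0&b_{1,2}&\cdots&0\\ \vdots&\vdots&\vdots&\ddots&\vdots\\ c_{1,N-1}&0&0&\cdots&b_{1,N-1}\end{pmatrix},\quad \bm A_0=\mathrm{diag}(\alpha_N,a_{1,1},\ldots,a_{1,N-1}),$$ and for $n\ge1$ $$\bm A_n=\mathrm{diag}(a_{n,N},a_{n+1,1},\ldots,a_{n+1,N-1}),\quad \bm B_n=\mathrm{diag}(b_{n,N},b_{n+1,1},\ldots,b_{n+1,N-1}),\quad \bm C_n=\mathrm{diag}(c_{n,N},c_{n+1,1},\ldots,c_{n+1,N-1}).$$ **Matrix-valued polynomials.** $(\bm Q_n)_{n\ge0}$ are the $N\times N$ matrix-valued polynomials generated by $$x\bm Q_n(x)=\bm A_n\bm Q_{n+1}(x)+\bm B_n\bm Q_n(x)+\bm C_n\bm Q_{n-1}(x),\quad n\geq0,\qquad \bm Q_0(x)=\bm I_N,\quad \bm Q_{-1}(x)=\bm 0.$$ Entrywise, $$\bm Q_n(x)=\begin{pmatrix} Q_{n,N}(x)&\alpha_1Q_{n,N}^{(0)}(x)&\cdots&\alpha_{N-1}Q_{n,N}^{(0)}(x)\\ Q_{n,1}^{(0)}(x)&Q_{n,1}(x)&\cdots&0\\ \vdots&\vdots&\ddots&\vdots\\ Q_{n,N-1}^{(0)}(x)&0&\cdots&Q_{n,N-1}(x)\end{pmatrix},$$ where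 (with $a_{0,N}=\alpha_N$, $b_{0,N}=\alpha_0$) $xQ_{n,N}=a_{n,N}Q_{n+1,N}+b_{n,N}Q_{n,N}+c_{n,N}Q_{n-1,N}$, $n\ge 0$, $Q_{0,N}=1$, $Q_{-1,N}=0$; $Q_{n,N}^{(0)}$ satisfies the same recurrence for $n\ge1$ with $Q_{0,N}^{(0)}=0$, $Q_{1,N}^{(0)}=-1/\alpha_N$; and for $k=1,\ldots,N-1$, $xQ_{n,k}=a_{n+1,k}Q_{n+1,k}+b_{n+1,k}Q_{n,k}+c_{n+1,k}Q_{n-1,k}$, $n\geq 0$, $Q_{0,k}=1$, $Q_{-1,k}=0$; and $Q_{n,k}^{(0)}$ satisfies the same recurrence for $n\ge1$ with $Q_{0,k}^{(0)}=0$, $Q_{1,k}^{(0)}=-c_{1,k}/a_{1,k}$. **Weight matrix.** An $N\times N$ weight matrix $\bm W$ on the real line is a matrix of measures such that $\bm W(A)$ is symmetric and nonnegative definite for every Borel set $A$, with finite moments. *)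

(* Defs.v *)
From mathcomp Require Import all_boot all_order all_algebra zify.
From mathcomp Require Import all_classical all_reals all_analysis.

Set Implicit Arguments.
Unset Strict Implicit.
Unset Printing Implicit Defensive.

Import Order.TTheory GRing.Theory Num.Theory.
Import numFieldNormedType.Exports.

Local Open Scope classical_set_scope.
Local Open Scope ring_scope.

(* [Point k m] is v_N(k+1, m+1) and [Body] is v_N(0): the ordinal m : 'I_N
   stands for the leg numbered m+1, and the N points v_N(0, m) are identified
   by construction. *)
Inductive spider (N : nat) : Type :=
  | Body
  | Point of nat & 'I_N.
Arguments Body {N}.

(* The parameters are indexed as on paper: alpha m for 0 <= m <= N, and
   a k m, b k m, c k m for 1 <= k and 1 <= m <= N; other values are unused. *)
Definition spider_parameters (R : realType) (N : nat)
    (alpha : nat -> R) (a b c : nat -> nat -> R) : Prop :=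
  [/\ \sum_(0 <= m < N.+1) alpha m = 1,
      0 <= alpha 0%N,
      forall m, (1 <= m <= N)%N -> 0 < alpha m &
      forall k m, (1 <= k)%N -> (1 <= m <= N)%N ->
        [/\ a k m + b k m + c k m = 1, 0 < a k m, 0 <= b k m & 0 < c k m]].

Definition spider_transition (R : realType) (N : nat)
    (alpha : nat -> R) (a b c : nat -> nat -> R) (s t : spider N) : R :=
  match s, t with
  | Body, Body => alpha 0%N
  | Body, Point 0 m => alpha m.+1
  | Body, Point _ _ => 0
  | Point 0 m, Body => c 1%N m.+1
  | Point _ _, Body => 0
  | Point k m, Point k' m' =>
      if m != m' then 0
      else if k' == k.+1 then a k.+1 m.+1
      else if k' == k then b k.+1 m.+1
      else if k == k'.+1 then c k.+1 m.+1
      else 0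
  end.

(* The initial distribution is arbitrary; the product form of the Markov
   property avoids conditioning on null events. *)
Definition homogeneous_markov_chain (d : measure_display)
    (T : measurableType d) (R : realType) (Pr : probability T R) (E : Type)
    (S : nat -> T -> E) (p : E -> E -> R) : Prop :=
  (forall n e, measurable [set w | S n w = e]) /\
  (forall n (s : nat -> E),
     Pr [set w | forall k, (k <= n.+1)%N -> S k w = s k] =
     (Pr [set w | forall k, (k <= n)%N -> S k w = s k]
      * (p (s n) (s n.+1))%:E)%E).

Definition spider_label (N : nat) (s : spider N) : nat :=
  match s with Body => 0%N | Point k m => (k * N + m.+1)%N end.

(* Row i of block n carries the label n * N + i, i.e. the state v_N(n, N) if
   i = 0 (the body if moreover n = 0), and v_N(n+1, i) otherwise. *)
Definition spider_A (R : realType) (N : nat) (alpha : nat -> R)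
    (a : nat -> nat -> R) (n : nat) : 'M[R]_N :=
  diag_mx (\row_(i < N)
    if i == 0%N :> nat then (if n == 0%N then alpha N else a n N)
    else a n.+1 i).

Definition spider_B (R : realType) (N : nat) (alpha : nat -> R)
    (b c : nat -> nat -> R) (n : nat) : 'M[R]_N :=
  if n == 0%N then
    \matrix_(i < N, j < N)
      if i == 0%N :> nat then alpha j
      else if j == 0%N :> nat then c 1%N i
      else if i == j then b 1%N i else 0
  else diag_mx (\row_(i < N) if i == 0%N :> nat then b n N else b n.+1 i).

(* C_n only makes sense for n >= 1. *)
Definition spider_C (R : realType) (N : nat) (c : nat -> nat -> R)
    (n : nat) : 'M[R]_N :=
  diag_mx (\row_(i < N) if i == 0%N :> nat then c n N else c n.+1 i).

(* A matrix-valued polynomial is represented by its matrix of polynomial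
   entries. The term C_0 Q_{-1} of the recurrence is 0. *)
Definition matrix_polynomials (R : realType) (N : nat)
    (A B C : nat -> 'M[R]_N) (Q : nat -> 'M[{poly R}]_N) : Prop :=
  Q 0%N = 1%:M /\
  forall n, 'X *: Q n =
    map_mx polyC (A n) *m Q n.+1 + map_mx polyC (B n) *m Q n
    + (if n is n'.+1 then map_mx polyC (C n) *m Q n' else 0).

Definition signed_measure_on (R : realType) : Type :=
  {charge set (measurableTypeR R) -> \bar R}.

Lemma charge_hahn (R : realType) (nu : signed_measure_on R) :
  exists PD, hahn_decomposition nu PD.1 PD.2.
Proof. by have [P [D h]] := Hahn_decomposition nu; exists (P, D). Qed.

(* The Jordan decomposition does not depend on the Hahn decomposition used. *)
Definition charge_pos (R : realType) (nu : signed_measure_on R) :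
    {measure set (measurableTypeR R) -> \bar R} :=
  jordan_pos (projT2 (cid (charge_hahn nu))).

Definition charge_neg (R : realType) (nu : signed_measure_on R) :
    {measure set (measurableTypeR R) -> \bar R} :=
  jordan_neg (projT2 (cid (charge_hahn nu))).

Definition charge_integral (R : realType) (nu : signed_measure_on R)
    (D : set R) (f : R -> R) : R :=
  \int[charge_pos nu]_(x in D) f x - \int[charge_neg nu]_(x in D) f x.

Definition matrix_measure (R : realType) (N : nat) : Type :=
  'I_N -> 'I_N -> signed_measure_on R.

Definition matrix_measure_at (R : realType) (N : nat)
    (W : matrix_measure R N) (A : set R) : 'M[R]_N :=
  \matrix_(i < N, j < N) fine (W i j A).

Definition weight_matrix (R : realType) (N : nat)
    (W : matrix_measure R N) : Prop :=
  (forall A : set (measurableTypeR R), measurable A ->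
     (matrix_measure_at W A)^T = matrix_measure_at W A /\
     forall v : 'rV[R]_N, 0 <= (v *m matrix_measure_at W A *m v^T) 0 0) /\
  (forall i j (n : nat),
     (charge_pos (W i j)).-integrable setT (fun x : R => (x ^+ n)%:E) /\
     (charge_neg (W i j)).-integrable setT (fun x : R => (x ^+ n)%:E)).

Definition supported_on (R : realType) (N : nat)
    (W : matrix_measure R N) (D : set R) : Prop :=
  forall A : set (measurableTypeR R), measurable A -> A `&` D = set0 ->
    matrix_measure_at W A = 0.

(* \int_D F(x) dW(x) G(x)^T *)
Definition matrix_integral (R : realType) (N : nat)
    (W : matrix_measure R N) (D : set R) (F G : 'M[{poly R}]_N) : 'M[R]_N :=
  \matrix_(i < N, j < N) \sum_(k < N) \sum_(l < N)
    charge_integral (W k l) D (fun x => (F i k).[x] * (G j l).[x]).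

Definition matrix_norm2 (R : realType) (N : nat)
    (W : matrix_measure R N) (F : 'M[{poly R}]_N) : 'M[R]_N :=
  matrix_integral W `[-1, 1] F F.

(* Checks: the labels enumerate the states, the transition matrix they induce
   has the blocks above, and the recurrence does determine Q. *)

Lemma spider_label_inj (N : nat) : injective (@spider_label N).
Proof.
move=> [|k m] [|k' m'] //=; rewrite ?addnS // => -[] e.
have N0 : (0 < N)%N by exact: leq_ltn_trans (ltn_ord m).
have ek : k = k'.
  by have := congr1 (divn^~ N) e; rewrite /= !divnMDl // !divn_small // !addn0.
by move: e; rewrite ek => /addnI /val_inj ->.
Qed.

Lemma spider_label_surj (N : nat) (l : nat) :
  (0 < N)%N -> exists s : spider N, spider_label s = l.
Proof.
move=> N0; case: l => [|l]; first by exists Body.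
exists (Point (l %/ N) (Ordinal (ltn_pmod l N0))) => /=.
by rewrite addnS -divn_eq.
Qed.

(* The state carried by row i of block n. *)
Lemma spider_block_state (N : nat) (s : spider N) (n : nat) (i : 'I_N) :
  spider_label s = (n * N + i)%N ->
  match s with
  | Body => n = 0%N /\ i = 0%N :> nat
  | Point k m => i = 0%N :> nat /\ n = k.+1 /\ m.+1 = N \/
                 0 < i /\ n = k /\ m.+1 = i
  end%N.
Proof.
have hi := ltn_ord i; case: s => [|k m] /=; first by nia.
have hm := ltn_ord m => e; have [i0|i0] := posnP i.
  left; rewrite i0 addn0 in e; have hn : n = k.+1 by nia.
  by split=> //; split=> //; rewrite hn mulSn in e; lia.
right; have hn : n = k by nia.
by split=> //; split=> //; rewrite hn in e; lia.
Qed.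

Lemma spider_transition_blocks (R : realType) (N : nat)
    (alpha : nat -> R) (a b c : nat -> nat -> R) (s t : spider N)
    (n n' : nat) (i j : 'I_N) :
  spider_label s = (n * N + i)%N -> spider_label t = (n' * N + j)%N ->
  spider_transition alpha a b c s t =
    if n' == n.+1 then spider_A N alpha a n i j
    else if n' == n then spider_B N alpha b c n i j
    else if n == n'.+1 then spider_C N c n i j
    else 0.
Proof.
move=> /spider_block_state + /spider_block_state.
have hi := ltn_ord i; have hj := ltn_ord j.
have Bij : spider_B N alpha b c n i j =
    if n == 0%N then
      (if i == 0%N :> nat then alpha j
       else if j == 0%N :> nat then c 1%N i else if i == j then b 1%N i else 0)
    else (if i == 0%N :> nat then b n N else b n.+1 i) *+ (i == j).
  rewrite /spider_B; case: ifP => _; rewrite !mxE //.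
rewrite Bij !mxE -!val_eqE /= {Bij}; move: hi hj.
case: i j => i /= _ [j /= _] hi hj.
case: s => [|k m]; case: t => [|k' m'] /=.
- by move=> [-> ->] [-> ->].
- move=> [-> ->] [[-> [-> mN]]|[j0 [-> mj]]] /=.
    by case: k' => [|k'] //=; rewrite mN.
  have /negbTE j0' : 0%N != j by lia.
  by case: k' => [|k'] /=; rewrite ?mj // j0' mulr0n if_same.
- move=> [[-> [-> mN]]|[i0 [-> mi]]] [-> ->] /=.
    by rewrite mN; case: k => [|k] //=; rewrite mulr0n.
  have i0n : (i == 0%N) = false by lia.
  by rewrite i0n; case: k => [|k] /=; rewrite ?mi ?i0n ?mulr0n ?if_same //.
- have -> (x y : R) : match k with 0%N | _ => if m != m' then x else y end
      = if m.+1 != m'.+1 then x else y by rewrite eqSS; case: k.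
  move=> [[-> [-> mN]]|[i0 [-> mi]]] [[-> [-> mN']]|[j0 [-> mj]]] /=.
  + rewrite mN mN' eqxx /= !eqSS.
    have [kk'|_] := eqVneq k' k; last by [].
    by rewrite kk'.
  + have /negbTE Nj : N != j by lia.
    have /negbTE j0n : 0%N != j by lia.
    by rewrite mN mj Nj j0n !mulr0n !if_same.
  + have /negbTE iN : i != N by lia.
    have /negbTE i0n : i != 0%N by lia.
    rewrite mi mN' iN i0n !mulr0n /=.
    case: k => [|k] /=; rewrite ?if_same //.
  + have /negbTE i0n : i != 0%N by lia.
    have /negbTE j0n : j != 0%N by lia.
    rewrite mi mj i0n j0n.
    have [_|_] /= := eqVneq i j; last by rewrite !mulr0n !if_same.
    by rewrite !mulr1n; case: k => [|k].
Qed.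

Lemma matrix_polynomials_unique_exist (R : realType) (N : nat)
    (alpha : nat -> R) (a b c : nat -> nat -> R) :
  (0 < N)%N -> spider_parameters N alpha a b c ->
  exists! Q, matrix_polynomials
    (spider_A N alpha a) (spider_B N alpha b c) (spider_C N c) Q.
Proof.
move=> N0 [_ _ alpha_gt0 abc].
set A := spider_A N alpha a; set B := spider_B N alpha b c.
set C := spider_C N c.
pose cst (M : 'M[R]_N) : 'M[{poly R}]_N := map_mx polyC M.
pose Ai n := cst (invmx (A n)).
have Au n : A n \in unitmx.
  rewrite unitmxE det_diag unitfE; apply/prodf_neq0 => i _; rewrite mxE.
  have iN := ltn_ord i; case: ifP => [_|i0]; last first.
    have [] // := abc n.+1 i; first by lia.
    by move=> _ /lt0r_neq0.
  case: ifP => n0; first by apply/lt0r_neq0/alpha_gt0; lia.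
  have [] // := abc n N; [by lia|by lia|].
  by move=> _ /lt0r_neq0.
have AiA n : Ai n *m cst (A n) = 1%:M.
  by rewrite -map_mxM mulVmx // map_mx1.
have AAi n : cst (A n) *m Ai n = 1%:M.
  by rewrite -map_mxM mulmxV // map_mx1.
pose step n (q : 'M[{poly R}]_N * 'M[{poly R}]_N) :=
  (q.2, Ai n *m ('X *: q.2 - cst (B n) *m q.2 - cst (C n) *m q.1)).
pose q := fix q n := if n is m.+1 then step m (q m) else (0, 1%:M).
exists (fun n => (q n).2); split=> [|Q [Q0 QS]].
  split=> // n; rewrite /= mulmxA [_ *m Ai n]AAi mul1mx.
  case: n => [|n] /=; first by rewrite mulmx0 subr0 addr0 subrK.
  by rewrite -[RHS]addrA [X in _ = _ + X]addrC [RHS]addrA !subrK.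
apply/funext => n; suff [] : (q n).2 = Q n /\ (q n.+1).2 = Q n.+1 by [].
have key n0 : Q n0.+1 = Ai n0 *m ('X *: Q n0 - cst (B n0) *m Q n0
    - (if n0 is n'.+1 then cst (C n0) *m Q n' else 0)).
  by rewrite QS [X in X - _ - _]addrAC !addrK mulmxA AiA mul1mx.
elim: n => [|n [IH1 IH2]].
  by rewrite key /= Q0 mulmx0.
by split=> //; rewrite key -IH1 -IH2.
Qed.

(* Main.v *)
From HB Require Import structures.
Require Import Defs.
From mathcomp Require Import all_boot all_order all_algebra zify ring lra.
From mathcomp Require Import all_classical all_reals all_analysis.
From mathcomp Require Import measurable_realfun.

(** The transition matrix P of the chain is reversible: with the weights w of
    [spider_weight], w(s) P(s,t) = w(t) P(t,s). Hence f |-> f P is a symmetric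
    contraction of the sequences indexed by the states, with inner product
    <f,g> = sum of f(s) g(s) / w(s), and W is the spectral measure of this
    operator at the unit vectors e_1, ..., e_N of the first block. No spectral
    theorem is used: W is rebuilt from its moments L_kl(p) = <e_k p(P), e_l>.

    Orthogonality holds already for the moments. Sending a row vector F of
    polynomials to the sum of the e_k F_k(P) turns multiplication by x into
    the action of P, and the recurrence for Q_n says exactly that row i of Q_n
    goes to the unit vector of row i of block n
    ([coord_matrix_polynomial]). Distinct unit vectors are orthogonal and have
    squared norms 1 / w, so the norm of Q_n is the diagonal matrix of the
    1 / w(n,i), which is invertible ([moment_orthogonality]).

    Positivity comes from the contraction inequality |<fP,f>| <= <f,f>, a
    consequence of reversibility and of row sums at most 1
    ([push_contraction]). For a real vector v the functional
    L_v = sum of v_k v_l L_kl therefore satisfies L_v(p^2 (1 + x)) >= 0 and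
    L_v(p^2 (1 - x)) >= 0, which suffices for L_v to be nonnegative on all
    products (1 + x)^k (1 - x)^l ([functional_ge0_of_squares]).

    This is the criterion of the Hausdorff moment problem, so L_v is the
    integral against a finite measure mu_v on [-1,1] ([hausdorff_moment]). That
    measure is the limit of the discrete measures with masses L(b_{n,k}) at the
    points k/n, b_{n,k} being the Bernstein polynomials; the limit is taken on
    the quantile functions, pointwise along an ultrafilter, so that the limit
    is again a monotone function and mu_v is an image of Lebesgue measure.

    The entries of W are obtained by polarization,
    W_kl = mu_{(e_k+e_l)/2} - mu_{(e_k-e_l)/2}. Nonnegativity of W(A) amounts to
    the sum of the v_k v_l W_kl(A) being mu_v(A). Both sides have the same
    moments, and a linear combination of finite measures on [-1,1] with
    vanishing moments vanishes ([moment_determinacy]), because on [-1,1]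
    indicators of half-lines are bounded pointwise limits of polynomials. *)

Set Implicit Arguments.
Unset Strict Implicit.
Unset Printing Implicit Defensive.

Import Order.TTheory GRing.Theory Num.Theory.
Import numFieldNormedType.Exports.

Local Open Scope classical_set_scope.
Local Open Scope ring_scope.

(** * Bernstein weights of a positive functional *)

Definition bernstein (R : comNzRingType) (n k : nat) : {poly R} :=
  ('X ^+ k * (1 - 'X) ^+ (n - k)) *+ 'C(n, k).

(** Factorial moments of the Bernstein weights are exact multiples of powers,
    which ordinary moments are not: k ^_ m 'C(n, k) = n ^_ m 'C(n-m, k-m)
    reduces the sum to the binomial theorem. *)
Lemma bernstein_factorial_moment (R : comNzRingType) (m n : nat) :
  \sum_(k < n.+1) bernstein R n k *+ k ^_ m = 'X ^+ m *+ n ^_ m.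
Proof.
elim: m n => [|m IH] n.
  rewrite expr0 ffactn0 mulr1n.
  rewrite -[RHS](expr1n _ n) -[in RHS](subrK 'X 1) exprDn.
  by apply: eq_bigr => k _; rewrite ffactn0 mulr1n /bernstein mulrC.
case: n => [|n].
  by rewrite big_ord_recl big_ord0 !ffact0n /= !mulr0n addr0.
rewrite big_ord_recl /= ffact0n mulr0n add0r ffactnS /=.
rewrite [RHS]mulrnA mulrnAC exprS -mulrnAr -IH mulr_sumr -sumrMnl.
apply: eq_bigr => k _; rewrite /bump /= add1n ffactnS /= /bernstein subSS.
rewrite exprS -!mulrnA mulrnAr -mulrnA -mulrA; congr (_ *+ _).
by have := mul_bin_diag n.+1 k; rewrite /=; nia.
Qed.

Lemma ffact_le_expn (n m : nat) : (n ^_ m <= n ^ m)%N.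
Proof.
elim: m => [|m IH]; first by rewrite ffactn0 expn0.
by rewrite ffactnSr expnSr leq_mul // leq_subr.
Qed.

(** Together with [ffact_le_expn]: for k <= n, replacing the factorial power by
    the power costs at most m ^ 2 / n, measured in units of n ^ (m+1). *)
Lemma expn_le_ffact (m k : nat) : (k ^ m.+1 <= k ^_ m.+1 + m ^ 2 * k ^ m)%N.
Proof.
elim: m => [|m IH]; first by rewrite ffactn1 expn1; lia.
have ff : (k * k ^_ m.+1 <= k ^_ m.+2 + m.+1 * k ^_ m.+1)%N.
  rewrite [k ^_ m.+2]ffactnSr.
  have [km|mk] := ltnP k m.+1; first by rewrite ffact_small //; lia.
  by rewrite [(k ^_ _ * _)%N]mulnC -mulnDl; apply: leq_mul => //; lia.
have le_ff := ffact_le_expn k m.+1.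
rewrite expnS; apply: (leq_trans (leq_mul (leqnn k) IH)).
rewrite mulnDr [(k * (m ^ 2 * _))%N]mulnCA -expnS.
have -> : (m.+1 ^ 2 = m ^ 2 + m + m.+1)%N by rewrite !expnS !expn0; lia.
move: (k ^_ m.+1)%N (k ^ m.+1)%N (k ^_ m.+2)%N (m ^ 2)%N ff le_ff.
by move=> x y z t; nia.
Qed.

Section moment_functional.
Variables (R : realType) (L : {scalar {poly R}}).
Hypothesis L_ge0 : forall k l, 0 <= L ('X ^+ k * (1 - 'X) ^+ l).

Lemma moment_ge0 m : 0 <= L ('X ^+ m).
Proof. by have := L_ge0 m 0; rewrite expr0 mulr1. Qed.

Lemma moment_le_mass m : L ('X ^+ m) <= L 1.
Proof.
elim: m => [|m]; first by rewrite expr0.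
apply: le_trans; rewrite -subr_ge0 -linearB /=.
by have := L_ge0 m 1; rewrite expr1 mulrBr mulr1 -exprSr.
Qed.

Lemma bernstein_weight_ge0 n k : 0 <= L (bernstein R n k).
Proof. by rewrite /bernstein linearMn mulrn_wge0. Qed.

Lemma bernstein_weight_sum n : \sum_(k < n.+1) L (bernstein R n k) = L 1.
Proof.
have := bernstein_factorial_moment R 0 n.
rewrite ffactn0 expr0 mulr1n => <-; rewrite linear_sum /=.
by apply: eq_bigr => k _; rewrite ffactn0 mulr1n.
Qed.

(** The discrete measure with masses L(b_{n,k}) at k / n has moments close to
    those of L: the factorial moments agree exactly, and both corrections
    from factorial powers to powers are between 0 and the same bound. *)
Lemma bernstein_moment_approx m n :
  `|\sum_(k < n.+2) L (bernstein R n.+1 k) * (k%:R / n.+1%:R) ^+ m.+1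
    - L ('X ^+ m.+1)| <= (m ^ 2)%:R * L 1 / n.+1%:R.
Proof.
set N := n.+1; have N0 : 0 < N%:R :> R by rewrite ltr0n.
have Nm0 : 0 < N%:R ^+ m.+1 :> R by rewrite exprn_gt0.
pose w k := L (bernstein R N k).
have w0 k : 0 <= w k by exact: bernstein_weight_ge0.
set e := (m ^ 2 * N ^ m)%:R * L 1.
have A : 0 <= \sum_(k < N.+1) w k * (k ^ m.+1)%:R
    - (N ^_ m.+1)%:R * L ('X ^+ m.+1) <= e.
  have -> : (N ^_ m.+1)%:R * L ('X ^+ m.+1) =
      \sum_(k < N.+1) w k * (k ^_ m.+1)%:R.
    rewrite mulr_natl -linearMn -bernstein_factorial_moment linear_sum /=.
    by apply: eq_bigr => k _; rewrite linearMn mulr_natr.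
  rewrite -sumrB; apply/andP; split.
    apply: sumr_ge0 => k _; rewrite -mulrBr mulr_ge0 // subr_ge0 ler_nat.
    exact: ffact_le_expn.
  rewrite /e -(bernstein_weight_sum N) mulr_sumr; apply: ler_sum => k _.
  rewrite -mulrBr mulrC ler_wpM2r //.
  rewrite lerBlDl -natrD ler_nat (leq_trans (expn_le_ffact m k)) //.
  rewrite leq_add2l leq_mul2l; apply/orP; right.
  by case: (m) => // j; rewrite leq_exp2r // -ltnS.
have B : 0 <= (N ^ m.+1)%:R * L ('X ^+ m.+1)
    - (N ^_ m.+1)%:R * L ('X ^+ m.+1) <= e.
  rewrite -mulrBl; apply/andP; split.
    rewrite mulr_ge0 ?moment_ge0 // subr_ge0 ler_nat.
    exact: ffact_le_expn.
  apply: ler_pM; rewrite ?moment_ge0 ?moment_le_mass //.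
    by rewrite subr_ge0 ler_nat ffact_le_expn.
  by rewrite lerBlDl -natrD ler_nat; exact: expn_le_ffact.
have -> : \sum_(k < N.+1) w k * (k%:R / N%:R) ^+ m.+1 =
    (\sum_(k < N.+1) w k * (k ^ m.+1)%:R) / N%:R ^+ m.+1.
  by rewrite mulr_suml; apply: eq_bigr => k _; rewrite expr_div_n natrX mulrA.
rewrite -(@ler_pM2r _ (N%:R ^+ m.+1)) //.
rewrite -[X in _ * X <= _](gtr0_norm Nm0) -normrM mulrBl divfK ?gt_eqF //.
rewrite [X in _ <= X](_ : _ = e); last first.
  by rewrite /e natrM !natrX [N%:R ^+ m.+1]exprS; field; rewrite gt_eqF.
rewrite -natrX [L _ * _]mulrC ler_norml; move: A B.
move=> /andP[A1 A2] /andP[B1 B2]; apply/andP; split; lra.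
Qed.

End moment_functional.


(** * Integrals of monotone functions *)

Section monotone_integral.
Variable R : realType.
Implicit Types (f : R -> R) (M : R).
Local Notation leb := (@lebesgue_measure R).

Lemma bounded_itv_integrable f (C : R) (b1 b2 : bool) (x y : R) :
  measurable_fun setT f -> (forall t, `|f t| <= C) ->
  leb.-integrable [set` Interval (BSide b1 x) (BSide b2 y)] (EFin \o f).
Proof.
move=> mf fC; apply: measurable_bounded_integrable => //.
- rewrite /= lebesgue_measure_itv /=.
  by case: ifP => // _; rewrite -EFinB ltry.
- exact: measurable_funTS.
- exists C; split; first by rewrite num_real.
  by move=> r Cr t _; exact: le_trans (fC t) (ltW Cr).
Qed.

Lemma Rintegral_itv_chop f (C : R) (c : nat -> R) (n : nat) :
  measurable_fun setT f -> (forall t, `|f t| <= C) ->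
  {homo c : i j / (i <= j)%N >-> i <= j} ->
  \int[leb]_(x in `[c 0%N, c n[) f x =
  \sum_(j < n) \int[leb]_(x in `[c j, c j.+1[) f x.
Proof.
move=> mf fC c_nd; elim: n => [|n IH].
  by rewrite big_ord0 set_itvco0 // Rintegral_set0.
rewrite big_ord_recr /= -IH.
rewrite (@itv_bndbnd_setU _ _ (BLeft (c 0%N)) (BLeft (c n)) (BLeft (c n.+1))).
- rewrite Rintegral_setU //.
    rewrite -itv_bndbnd_setU ?bnd_simp ?c_nd //.
    exact: bounded_itv_integrable fC.
  apply/disj_set2P; rewrite -subset0 => x [] /=; rewrite !in_itv /=.
  by move=> /andP[_ xc] /andP[cx _]; move: (lt_le_trans xc cx); rewrite ltxx.
- by rewrite bnd_simp c_nd.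
- by rewrite bnd_simp c_nd.
Qed.

Lemma Rintegral_itv_cst (r x y : R) :
  x <= y -> \int[leb]_(t in `[x, y[) r = r * (y - x).
Proof.
move=> xy; rewrite Rintegral_cst //= lebesgue_measure_itv /= lte_fin.
by case: ltgtP xy => // -> _; rewrite subrr.
Qed.

(** Lower and upper sums differ by one cell times f(M) - f(0). The bound is
    uniform in f, so it survives pointwise limits of functions. *)
Lemma riemann_sum_approx f M (n : nat) :
  {homo f : x y / x <= y} -> (forall x, 0 <= f x <= 1) -> 0 <= M ->
  `|\int[leb]_(x in `[0, M]) f x
    - M / n.+1%:R * \sum_(j < n.+1) f (j%:R * (M / n.+1%:R))| <= M / n.+1%:R.
Proof.
move=> f_nd f01 M0; set h := M / n.+1%:R.
have h0 : 0 <= h by rewrite divr_ge0.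
have mf := nondecreasing_measurable measurableT f_nd.
have f1 t : `|f t| <= 1.
  by have /andP[f0 ft] := f01 t; rewrite ger0_norm.
have Mh : M = n.+1%:R * h by rewrite /h mulrC divfK.
have h_nd : {homo (fun j : nat => j%:R * h) : i j / (i <= j)%N >-> i <= j}.
  by move=> i j ij; rewrite ler_wpM2r // ler_nat.
rewrite -Rintegral_itv_bndo_bndc; last exact: bounded_itv_integrable f1.
rewrite {1}Mh -[X in `[X, _[](mul0r h) (Rintegral_itv_chop n.+1 mf f1 h_nd).
rewrite mulr_sumr.
have cell j : h * f (j%:R * h) <= \int[leb]_(x in `[j%:R * h, j.+1%:R * h[) f x
    <= h * f (j.+1%:R * h).
  have jh : j%:R * h <= j.+1%:R * h by exact: h_nd.
  have cstE r : h * r = \int[leb]_(x in `[j%:R * h, j.+1%:R * h[) r.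
    by rewrite Rintegral_itv_cst // -mulrBl -natrB // subSnn mul1r mulrC.
  have cst_int r : leb.-integrable `[j%:R * h, j.+1%:R * h[ (EFin \o fun=> r).
    by apply: (bounded_itv_integrable (C := `|r|)).
  have f_int : leb.-integrable `[j%:R * h, j.+1%:R * h[ (EFin \o f).
    exact: bounded_itv_integrable mf f1.
  rewrite !cstE; apply/andP; split; apply: le_Rintegral => // t /=.
    by rewrite in_itv /= => /andP[? _]; exact: f_nd.
  by rewrite in_itv /= => /andP[_ /ltW ?]; exact: f_nd.
have lo : 0 <= \sum_(j < n.+1) (\int[leb]_(x in `[j%:R * h, j.+1%:R * h[) f x
    - h * f (j%:R * h)).
  by apply: sumr_ge0 => j _; rewrite subr_ge0; have /andP[] := cell j.
have hi : \sum_(j < n.+1) (\int[leb]_(x in `[j%:R * h, j.+1%:R * h[) f x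
    - h * f (j%:R * h)) <= h.
  apply: (@le_trans _ _ (\sum_(j < n.+1) (h * f (j.+1%:R * h) - h * f (j%:R * h)))).
    by apply: ler_sum => j _; rewrite lerD2r; have /andP[] := cell j.
  rewrite -(big_mkord xpredT (fun j => h * f (j.+1%:R * h) - h * f (j%:R * h))).
  rewrite telescope_sumr // -mulrBr -[leRHS]mulr1 ler_wpM2l //.
  have /andP[_ a1] := f01 (n.+1%:R * h); have /andP[b0 _] := f01 (0%:R * h).
  by lra.
by rewrite -sumrB ger0_norm.
Qed.

End monotone_integral.


(** * Quantile functions and the Hausdorff moment problem *)

Section quantile.
Variable R : realType.
Local Notation leb := (@lebesgue_measure R).

(** For nondecreasing cumulative masses c this is the index of the atom reached
    at level s, a generalized inverse of the distribution function; as a count,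
    it is monotone in s at sight. *)
Definition quantile_index (c : nat -> R) (n : nat) (s : R) : nat :=
  \sum_(j < n) (c j.+1 <= s)%R.

Lemma quantile_index_le c n s : (quantile_index c n s <= n)%N.
Proof.
rewrite -[leqRHS]card_ord -sum1_card.
by apply: leq_sum => j _; exact: leq_b1.
Qed.

Lemma quantile_index_nd c n : {homo quantile_index c n : s t / s <= t >-> (s <= t)%N}.
Proof.
move=> s t st; apply: leq_sum => j _.
by case: (leP _ s) => // cs; rewrite (le_trans cs st).
Qed.

Lemma quantile_indexE c n j s : {homo c : i j / (i <= j)%N >-> i <= j} ->
  (j <= n)%N -> c j <= s < c j.+1 -> quantile_index c n s = j.
Proof.
move=> c_nd jn /andP[cjs scj].
rewrite /quantile_index (eq_bigr (fun i : 'I_n => nat_of_bool (i < j)%N)); last first.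
  move=> i _; congr nat_of_bool; apply/idP/idP => [cis|ij].
    rewrite ltnNge; apply/negP => ji.
    by have := le_lt_trans cis scj; rewrite ltNge c_nd.
  exact: le_trans (c_nd _ _ ij) cjs.
rewrite -(big_mkord xpredT (fun i => nat_of_bool (i < j)%N)).
rewrite (big_cat_nat (leq0n j) jn) //= big_nat (eq_bigr (fun=> 1%N)); last first.
  by move=> i /andP[_ ->].
rewrite -big_nat sum_nat_const_nat subn0 muln1 big_nat big1 ?addn0 //.
by move=> i /andP[ji _]; rewrite ltnNge ji.
Qed.

(** The quantile function transports Lebesgue measure to the discrete measure
    with mass c(k+1) - c(k) at k / n; here for the power functions. *)
Lemma Rintegral_quantile (c : nat -> R) n m :
  {homo c : i j / (i <= j)%N >-> i <= j} -> c 0%N = 0 ->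
  \int[leb]_(s in `[0, c n.+2]) ((quantile_index c n.+1 s)%:R / n.+1%:R) ^+ m =
  \sum_(k < n.+2) (c k.+1 - c k) * (k%:R / n.+1%:R) ^+ m.
Proof.
move=> c_nd c0.
pose f s : R := ((quantile_index c n.+1 s)%:R / n.+1%:R) ^+ m.
rewrite -[LHS]/(\int[leb]_(s in `[0, c n.+2]) f s).
have n0 : 0 < n.+1%:R :> R by rewrite ltr0n.
have f_nd : {homo f : x y / x <= y}.
  move=> s t st; rewrite /f lerXn2r ?nnegrE ?divr_ge0 //.
  by rewrite ler_pM2r ?invr_gt0 // ler_nat quantile_index_nd.
have f1 t : `|f t| <= 1.
  rewrite /f ger0_norm ?exprn_ge0 ?divr_ge0 // exprn_ile1 ?divr_ge0 //.
  by rewrite ler_pdivrMr // mul1r ler_nat quantile_index_le.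
have mf := nondecreasing_measurable measurableT f_nd.
rewrite -Rintegral_itv_bndo_bndc; last exact: bounded_itv_integrable f1.
rewrite -[X in `[X, _[]c0 (Rintegral_itv_chop n.+2 mf f1 c_nd).
apply: eq_bigr => j _; rewrite mulrC -Rintegral_itv_cst; last exact: c_nd.
apply: eq_Rintegral => s; rewrite inE /= in_itv /= => cs.
by rewrite /f (quantile_indexE _ _ cs) // -ltnS.
Qed.

End quantile.

Lemma ultra_limit_exists (R : realType) (T : Type) (U : set_system T)
    (u : T -> R) (a b : R) : UltraFilter U -> (forall t, a <= u t <= b) ->
  exists2 l, a <= l <= b & u t @[t --> U] --> l.
Proof.
move=> UU uab; have PU : ProperFilter U by exact: ultra_proper.
have Uab : (u @ U) `[a, b]%classic.
  apply: (@filterE _ U) => t /=; rewrite in_itv /=; exact: uab.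
have [l [lab cl]] := @segment_compact R a b (u @ U) _ Uab.
exists l; first by move: lab; rewrite /= in_itv.
move=> B lB; have [//|UnB] := in_ultra_setVsetC (u @^-1` B) UU.
by have [x [nBx Bx]] := cl (~` B) B UnB lB.
Qed.

(** The quantile functions of the Bernstein measures converge pointwise along
    an ultrafilter. Dominated convergence is not available along an
    ultrafilter, but the powers of quantile functions are monotone, so their
    integrals are uniformly close to Riemann sums, which involve finitely many
    points and do converge. *)
Theorem hausdorff_quantile (R : realType) (L : {scalar {poly R}}) :
  (forall k l, 0 <= L ('X ^+ k * (1 - 'X) ^+ l)) ->
  exists q : R -> R, [/\ {homo q : s t / s <= t}, forall s, 0 <= q s <= 1 &
    forall m, \int[@lebesgue_measure R]_(s in `[0, L 1]) q s ^+ m = L ('X ^+ m)].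
Proof.
move=> L_ge0; set M := L 1.
have M0 : 0 <= M by have := L_ge0 0 0; rewrite mulr1.
pose c n j := \sum_(k < j) L (bernstein R n k).
have c_nd n : {homo c n : i j / (i <= j)%N >-> i <= j}.
  move=> i j /subnKC <-; rewrite /c big_split_ord /= lerDl.
  by apply: sumr_ge0 => k _; exact: bernstein_weight_ge0.
have c0 n : c n 0%N = 0 by rewrite /c big_ord0.
have cM n : c n.+1 n.+2 = M by rewrite /c bernstein_weight_sum.
pose qn n s : R := (quantile_index (c n.+1) n.+1 s)%:R / n.+1%:R.
have qn01 n s : 0 <= qn n s <= 1.
  rewrite divr_ge0 //= ler_pdivrMr ?ltr0n // mul1r ler_nat.
  exact: quantile_index_le.
have qn_nd n : {homo qn n : s t / s <= t}.
  move=> s t st; rewrite ler_pM2r ?invr_gt0 ?ltr0n // ler_nat.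
  exact: quantile_index_nd.
have [U [UU ooU]] := @ultraFilterLemma nat \oo _.
have PU : ProperFilter U by exact: ultra_proper.
have /choice[q qP] (s : R) : exists l : R, 0 <= l <= 1 /\ qn n s @[n --> U] --> l.
  by have [l] := ultra_limit_exists UU (qn01 ^~ s); exists l.
have q01 s : 0 <= q s <= 1 by have [] := qP s.
have q_nd : {homo q : s t / s <= t}.
  move=> s t st; have [_ qs] := qP s; have [_ qt] := qP t.
  by apply: ler_cvg_to qs qt _; apply: nearW => n; exact: qn_nd.
exists q; split=> // -[|m].
  rewrite expr0 -/M Rintegral_cst //= lebesgue_measure_itv /= mul1r lte_fin.
  by case: ltgtP M0 => //= *; rewrite ?subr0.
pose X m (f : R -> R) := fun s => f s ^+ m.
have X_nd f : {homo f : s t / s <= t} -> (forall s, 0 <= f s <= 1) ->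
    {homo X m.+1 f : s t / s <= t}.
  move=> f_nd f01 s t st; rewrite /X lerXn2r ?nnegrE ?f_nd //.
    by have /andP[] := f01 s.
  by have /andP[] := f01 t.
have X01 f : (forall s, 0 <= f s <= 1) -> forall s, 0 <= X m.+1 f s <= 1.
  by move=> f01 s; have /andP[f0 f1] := f01 s; rewrite exprn_ge0 ?exprn_ile1.
pose S J (f : R -> R) :=
  M / J.+1%:R * \sum_(j < J.+1) X m.+1 f (j%:R * (M / J.+1%:R)).
have S_cvg J : S J (qn n) @[n --> U] --> S J q.
  apply: cvgM; first exact: cvg_cst.
  apply: cvg_big => [|j _]; first exact: add_continuous.
  have [_ qj] := qP (j%:R * (M / J.+1%:R)).
  exact: (cvg_comp _ _ qj (@exprn_continuous R m.+1 _)).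
have dist_tri (x y z e1 e2 : R) :
    `|x - y| <= e1 -> `|x - z| <= e2 -> `|y - z| <= e2 + e1.
  rewrite !ler_norml => /andP[? ?] /andP[? ?]; apply/andP; split; lra.
have L_approx J n : `|L ('X ^+ m.+1) - S J (qn n)| <=
    M / J.+1%:R + (m ^ 2)%:R * M / n.+1%:R.
  have := riemann_sum_approx J (X_nd _ (qn_nd n) (qn01 n)) (X01 _ (qn01 n)) M0.
  rewrite -/(S J (qn n)) -{1}(cM n) (Rintegral_quantile n m.+1 (c_nd _) (c0 _)).
  under eq_bigr do rewrite /c big_ord_recr /= addrAC subrr add0r.
  have := bernstein_moment_approx L_ge0 m n; rewrite -/M.
  exact: dist_tri.
have S_approx J : `|L ('X ^+ m.+1) - S J q| <= M / J.+1%:R.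
  have lim_l : `|L ('X ^+ m.+1) - S J (qn n)| @[n --> U] -->
      `|L ('X ^+ m.+1) - S J q|.
    by apply: cvg_norm; apply: cvgB; [exact: cvg_cst|exact: S_cvg].
  have lim_r : M / J.+1%:R + (m ^ 2)%:R * M / n.+1%:R @[n --> U] -->
      M / J.+1%:R + (m ^ 2)%:R * M * 0.
    apply: cvgD; first exact: cvg_cst.
    apply: cvgM; first exact: cvg_cst.
    by apply: cvg_trans cvg_harmonic => A; exact: ooU.
  rewrite mulr0 addr0 in lim_r.
  by apply: ler_cvg_to lim_l lim_r _; apply: nearW => n; exact: L_approx.
set I := Rintegral _ _ _.
have I_approx J : `|I - L ('X ^+ m.+1)| <= 2 * M / J.+1%:R.
  have := riemann_sum_approx J (X_nd _ q_nd q01) (X01 _ q01) M0.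
  rewrite -/(S J q) -/I; move: (S_approx J); rewrite !ler_norml.
  rewrite -[2 * M / _]mulrA.
  move: (M / _) => e /andP[? ?] /andP[? ?]; apply/andP; split; lra.
apply/eqP; rewrite -subr_eq0 -normr_le0.
have lim : 2 * M / J.+1%:R @[J --> \oo] --> 2 * M * 0.
  by apply: cvgM; [exact: cvg_cst|exact: cvg_harmonic].
rewrite mulr0 in lim.
by apply: ler_cvg_to (cvg_cst _) lim _; apply: nearW => J; exact: I_approx.
Qed.

Section finite_pushforward.
Context d1 d2 (T1 : measurableType d1) (T2 : measurableType d2) (R : realType).
Variables (m : {finite_measure set T1 -> \bar R}) (f : T1 -> T2).
Hypothesis mf : measurable_fun setT f.

(** An image measure with its proof of measurability as an argument, so that
    the finite measure structure can be inferred. *)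
Definition finite_pushforward (mf : measurable_fun setT f) : set T2 -> \bar R :=
  pushforward m f.

HB.instance Definition _ := Measure.copy (finite_pushforward mf)
  (measure_function_pushforward__canonical__measure_function_Measure m mf).

Let finite_pushforward_fin : fin_num_fun (finite_pushforward mf).
Proof.
move=> A mA; rewrite /finite_pushforward /pushforward fin_num_measure //.
by rewrite -[X in measurable X]setTI; exact: mf.
Qed.

HB.instance Definition _ := @Measure_isFinite.Build _ _ _
  (finite_pushforward mf) finite_pushforward_fin.

End finite_pushforward.

Section affine_change.
Variables (R : realType) (L : {scalar {poly R}}).

Definition unit_to_sym : {poly R} := 2 *: 'X - 1.
Definition sym_to_unit : {poly R} := 2^-1 *: (1 + 'X).

Definition unit_functional (p : {poly R}) : R^o := L (p \Po sym_to_unit).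

Lemma unit_functional_scalar : scalar unit_functional.
Proof. by move=> k p q; rewrite /unit_functional !linearP. Qed.

HB.instance Definition _ := GRing.isLinear.Build R {poly R} R^o _
  unit_functional unit_functional_scalar.

End affine_change.

Lemma horner_norm_le (R : realDomainType) (p : {poly R}) (x : R) :
  `|x| <= 1 -> `|p.[x]| <= \sum_(i < size p) `|p`_i|.
Proof.
move=> x1; rewrite horner_coef (le_trans (ler_norm_sum _ _ _)) //.
apply: ler_sum => i _; rewrite normrM normrX ler_piMr ?exprn_ile1 //.
Qed.

Lemma Rintegral_horner_moment (R : realType) d (T : measurableType d)
    (m : {measure set T -> \bar R}) (D : set T) (q : T -> R)
    (L : {scalar {poly R}}) (p : {poly R}) :
  measurable D -> (forall i, m.-integrable D (EFin \o (fun s => q s ^+ i))) ->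
  (forall i, \int[m]_(s in D) q s ^+ i = L ('X ^+ i)) ->
  \int[m]_(s in D) p.[q s] = L p.
Proof.
move=> mD qi qL.
suff H n : m.-integrable D (EFin \o (fun s => \sum_(i < n) p`_i * q s ^+ i)) /\
    \int[m]_(s in D) \sum_(i < n) p`_i * q s ^+ i =
    \sum_(i < n) p`_i * L ('X ^+ i).
  under eq_Rintegral do rewrite horner_coef.
  rewrite (H (size p)).2 -[in RHS](coefK p) poly_def linear_sum /=.
  by apply: eq_bigr => i _; rewrite linearZ.
have piq i : m.-integrable D (EFin \o (fun s => p`_i * q s ^+ i)).
  exact: (integrableZl mD _ (qi i)).
elim: n => [|n [IHi IH]].
  split; last by under eq_Rintegral do rewrite big_ord0; rewrite Rintegral_cst // mul0r big_ord0.
  rewrite (_ : _ \o _ = cst 0%E); first exact: integrable0.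
  by apply/funext => s /=; rewrite big_ord0.
split.
  rewrite (_ : _ \o _ = fun s =>
      (EFin (\sum_(i < n) p`_i * q s ^+ i)%R + EFin (p`_n * q s ^+ n)%R)%E).
    exact: (integrableD mD IHi (piq n)).
  by apply/funext => s /=; rewrite big_ord_recr.
under eq_Rintegral do rewrite big_ord_recr /=.
rewrite RintegralD // IH RintegralZl // qL.
by rewrite big_ord_recr.
Qed.

Definition carried_by (R : realType)
    (mu : {finite_measure set (measurableTypeR R) -> \bar R}) (D : set R) : Prop :=
  mu (~` D) = 0%E.

(** The hypothesis is Hausdorff's criterion transported from [0,1] to [-1,1]
    by x = 2 y - 1; the measure is the image of Lebesgue measure on
    [0, L(1)] under 2 q - 1, where q is a limit quantile function. *)
Theorem hausdorff_moment (R : realType) (L : {scalar {poly R}}) :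
  (forall k l, 0 <= L ((1 + 'X) ^+ k * (1 - 'X) ^+ l)) ->
  exists mu : {finite_measure set (measurableTypeR R) -> \bar R},
    carried_by mu `[-1, 1] /\
    forall p : {poly R}, \int[mu]_(x in `[-1, 1]) p.[x] = L p.
Proof.
move=> L_ge0.
have cX_sym : unit_to_sym R \Po sym_to_unit R = 'X.
  rewrite /sym_to_unit /unit_to_sym linearB linearZ /= comp_polyX -polyC1.
  by rewrite comp_polyC scalerA divff ?scale1r ?pnatr_eq0 // addrC addKr.
have [|q [q_nd q01 qL]] := @hausdorff_quantile R (unit_functional L).
  move=> k l; rewrite /= /unit_functional rmorphM !rmorphXn /= comp_polyX.
  have -> : (1 - 'X) \Po sym_to_unit R = 2^-1 *: (1 - 'X).
    rewrite linearB /= comp_polyX -polyC1 comp_polyC /sym_to_unit polyC1.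
    rewrite scalerDr scalerBr opprD addrA -{1}[1](scale1r (1 : {poly R})).
    rewrite -scalerBl; congr (_ *: _ - _); by field.
  rewrite /sym_to_unit !exprZn -scalerAl -scalerAr scalerA linearZ /=.
  by rewrite mulr_ge0 // mulr_ge0 // exprn_ge0 // invr_ge0.
set M := unit_functional L 1 in qL.
pose phi s := 2 * q s - 1.
have phi_sym s : phi s \in `[-1, 1].
  by rewrite in_itv /=; have /andP[] := q01 s; rewrite /phi => *; apply/andP; split; lra.
have mphi : measurable_fun setT (phi : measurableTypeR R -> measurableTypeR R).
  apply: nondecreasing_measurable => // s t st.
  by rewrite lerD2r ler_pM2l // q_nd.
have mM : measurable (`[0, M]%classic : set (measurableTypeR R)) by [].
have leb_fin : (lebesgue_measure `[0%R, M]%classic < +oo)%E.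
  by rewrite lebesgue_measure_itv /=; case: ifP => // _; rewrite -EFinB ltry.
exists (finite_pushforward (mfrestr mM leb_fin) mphi); split=> [|p].
  rewrite /carried_by /= /finite_pushforward /pushforward /mfrestr /mrestr.
  rewrite (_ : phi @^-1` _ = set0) ?set0I ?measure0 //.
  by apply/seteqP; split=> // s /=; apply; exact: phi_sym.
have phi_preim : phi @^-1` `[-1, 1]%classic = setT.
  by apply/seteqP; split=> // s _; exact: phi_sym.
have mp : measurable_fun setT (fun x : measurableTypeR R => (p.[x])%:E).
  by apply/measurable_EFinP; exact: measurable_poly.
have phi1 s : `|phi s| <= 1 by rewrite ler_norml; exact: phi_sym.
pose r := p \Po unit_to_sym R.
have rE s : p.[phi s] = r.[q s].
  by rewrite horner_comp /unit_to_sym !hornerE.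
pose m := mfrestr mM leb_fin.
have q_int i : (@lebesgue_measure R).-integrable `[0, M] (EFin \o (fun s => q s ^+ i)).
  apply: (bounded_itv_integrable (C := 1)).
    by apply: measurable_funX; exact: nondecreasing_measurable.
  move=> t; have /andP[q0 q1] := q01 t.
  by rewrite ger0_norm ?exprn_ge0 // exprn_ile1.
have pphi_int : m.-integrable setT (EFin \o (fun s => p.[phi s])).
  apply: measurable_bounded_integrable => //.
  - by rewrite /m /= /mfrestr /mrestr setTI.
  - exact: (measurableT_comp (measurable_poly p (A := setT)) mphi).
  - exists (\sum_(i < size p) `|p`_i|); split; first by rewrite num_real.
    by move=> C pC t _; apply: le_trans (ltW pC); exact: horner_norm_le.
transitivity (\int[@lebesgue_measure R]_(s in `[0, M]) r.[q s]).
  congr fine; transitivity (\int[m]_(s in phi @^-1` `[(-1)%R, 1%R]%classic) (p.[phi s])%:E)%E.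
    have mS : measurable (`[(-1)%R, 1%R]%classic : set (measurableTypeR R)) by [].
    have pphi_intS : m.-integrable (phi @^-1` `[(-1)%R, 1%R]%classic)
        ((fun x => (p.[x])%:E) \o phi) by rewrite phi_preim.
    exact: (integral_pushforward mphi mp pphi_intS mS).
  have mN : measurable (~` (`[0, M]%classic : set (measurableTypeR R))).
    exact: measurableC.
  have N0 : m (~` `[0, M]%classic) = 0%E.
    by rewrite /m /= /mfrestr /mrestr setICl measure0.
  rewrite phi_preim; etransitivity.
    exact: (negligible_integral mN measurableT pphi_int N0).
  rewrite setDE setCK setTI; under eq_integral do rewrite /= rE.
  apply: eq_measure_integral => A mA AM.
  by rewrite /m /= /mfrestr /mrestr setIidl.
rewrite (Rintegral_horner_moment r _ q_int qL) //.
by rewrite /= /unit_functional /r -comp_polyA cX_sym comp_polyXr.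
Qed.


(** * Determinacy of moments on a bounded interval *)

Lemma bernoulli_ineq (R : realDomainType) (u : R) (n : nat) :
  -1 <= u -> 1 + n%:R * u <= (1 + u) ^+ n.
Proof.
move=> u1; elim: n => [|n IH]; first by rewrite mul0r addr0 expr0.
rewrite exprS; apply: le_trans (_ : _ <= (1 + u) * (1 + n%:R * u)) _.
  rewrite -natr1; have : 0 <= n%:R * u ^+ 2 by rewrite mulr_ge0 ?sqr_ge0.
  move: n%:R => x ?; lra.
by rewrite ler_wpM2l // -lerBlDl add0r.
Qed.

Section threshold.
Variables (R : realType) (tau : R).
Hypothesis tau01 : 0 < tau < 1.

(** The polynomials 1 - (1 - y^(2n))^j with j of order tau^(-2n) / n. For
    y <= tau the product j y^(2n) is at most about 1 / n and the value tends
    to 0, also at y = tau; for y > tau the product tends to infinity and the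
    value tends to 1. The factor 1 / n is what decides the case y = tau, and
    the even power makes (y / tau)^(2n) beat n. *)
Definition threshold_exponent (n : nat) : nat :=
  (Num.trunc ((tau ^+ (n.+1 * 2))^-1 / n.+1%:R)).+1.

Definition threshold_poly (n : nat) : {poly R} :=
  1 - (1 - 'X ^+ (n.+1 * 2)) ^+ threshold_exponent n.

Lemma threshold_poly01 n y : 0 <= y <= 1 -> 0 <= (threshold_poly n).[y] <= 1.
Proof.
move=> /andP[y0 y1]; rewrite !hornerE.
have u0 : 0 <= y ^+ (n.+1 * 2) by rewrite exprn_ge0.
have u1 : y ^+ (n.+1 * 2) <= 1 by rewrite exprn_ile1.
have v0 : 0 <= 1 - y ^+ (n.+1 * 2) by rewrite subr_ge0.
have v1 : 1 - y ^+ (n.+1 * 2) <= 1 by rewrite gerBl.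
by rewrite subr_ge0 exprn_ile1 //= gerBl exprn_ge0.
Qed.

Lemma threshold_poly_below n y :
  0 <= y <= tau -> (threshold_poly n).[y] <= n.+1%:R^-1 + tau ^+ (n.+1 * 2).
Proof.
move=> /andP[y0 yt]; have /andP[t0 t1] := tau01.
rewrite !hornerE; set N := (n.+1 * 2)%N; set j := threshold_exponent n.
have yN1 : y ^+ N <= 1 by rewrite exprn_ile1 // (le_trans yt) // ltW.
have b : 1 + j%:R * - y ^+ N <= (1 - y ^+ N) ^+ j.
  by apply: bernoulli_ineq; rewrite lerN2.
rewrite mulrN in b; apply: (@le_trans _ _ (j%:R * y ^+ N)); first by lra.
apply: (@le_trans _ _ (j%:R * tau ^+ N)).
  by rewrite ler_wpM2l // lerXn2r // ?nnegrE // ltW.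
have tN : 0 < tau ^+ N by rewrite exprn_gt0.
rewrite /j /threshold_exponent -natr1 mulrDl mul1r lerD2r.
by rewrite -ler_pdivlMr // [leRHS]mulrC truncn_le divr_ge0 // invr_ge0 ltW.
Qed.

(** With u = y^(2n), Bernoulli's inequality and (1 - u)(1 + u) <= 1 give
    (1 - u)^j (1 + j u) <= 1. *)
Lemma threshold_poly_above n y : tau < y <= 1 ->
  1 - (threshold_poly n).[y] <= n.+1%:R^-1 / (y / tau - 1) ^+ 2.
Proof.
move=> /andP[ty y1]; have /andP[t0 t1] := tau01.
have y0 : 0 < y by exact: lt_trans ty.
rewrite !hornerE opprB addrC subrK.
set N := (n.+1 * 2)%N; set j := threshold_exponent n; set u := y ^+ N.
have u0 : 0 < u by rewrite exprn_gt0.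
have u1 : u <= 1 by rewrite exprn_ile1 // ltW.
have n0 : 0 < n.+1%:R :> R by rewrite ltr0n.
set d := y / tau - 1.
have d0 : 0 < d by rewrite subr_gt0 ltr_pdivlMr // mul1r.
have b : 1 + j%:R * u <= (1 + u) ^+ j.
  by apply: bernoulli_ineq; apply: le_trans (ltW u0); rewrite oppr_le0.
have prod1 : (1 - u) ^+ j * (1 + u) ^+ j <= 1.
  rewrite -exprMn -subr_sqr expr1n exprn_ile1 //.
    by rewrite subr_ge0 exprn_ile1 // ltW.
  by rewrite gerBl sqr_ge0.
have ju : n.+1%:R * d ^+ 2 <= j%:R * u.
  apply: (@le_trans _ _ ((y / tau) ^+ N / n.+1%:R)).
    rewrite ler_pdivlMr // mulrAC -expr2 -exprMn /N exprM.
    rewrite lerXn2r ?nnegrE ?exprn_ge0 ?divr_ge0 ?mulr_ge0 // ltW //.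
    have := @bernoulli_ineq R d n.+1; rewrite /d [1 + (_ - 1)]addrC subrK.
    move=> h; apply: lt_le_trans (h _); first by rewrite ltr_pwDl.
    by rewrite -/d (le_trans _ (ltW d0)) // oppr_le0.
  rewrite expr_div_n -/u mulrAC [leRHS]mulrC -mulrA ler_wpM2l //; first exact: ltW.
  by rewrite mulrC /j /threshold_exponent ltW // mulrC truncnS_gt.
have v0 : 0 <= (1 - u) ^+ j by rewrite exprn_ge0 // subr_ge0.
rewrite -invfM -[leRHS]div1r ler_pdivlMr; last by rewrite mulr_gt0 // exprn_gt0.
apply: le_trans prod1; rewrite ler_wpM2l //; apply: le_trans b.
by apply: le_trans ju _; rewrite lerDr.
Qed.

Lemma threshold_poly_cvg (y : R) : 0 <= y <= 1 ->
  (threshold_poly n).[y] @[n --> \oo] -->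
    (if tau < y then 1 else 0 : R).
Proof.
move=> y01; have /andP[y0 y1] := y01; have /andP[t0 t1] := tau01.
have inv0 : n.+1%:R^-1 @[n --> \oo] --> (0 : R) by exact: cvg_harmonic.
case: (ltP tau y) => [ty|yt] /=.
  set D := (y / tau - 1) ^+ 2.
  have lo : 1 - n.+1%:R^-1 / D @[n --> \oo] --> 1 - 0 / D.
    by apply: cvgB; [exact: cvg_cst|apply: cvgM => //; exact: cvg_cst].
  rewrite mul0r subr0 in lo.
  apply: (squeeze_cvgr _ lo (cvg_cst (1 : R))); apply: nearW => n.
  have /andP[_ ->] := threshold_poly01 n y01; rewrite andbT.
  by rewrite lerBlDr -lerBlDl threshold_poly_above // ty.
have hi : n.+1%:R^-1 + tau ^+ (n.+1 * 2) @[n --> \oo] --> 0 + tau ^+ 2 * 0.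
  apply: cvgD => //; under eq_cvg do rewrite mulnC exprM exprS.
  apply: cvgM; first exact: cvg_cst.
  by apply: cvg_expr; rewrite ger0_norm ?exprn_ge0 ?exprn_ilt1 ?ltW.
rewrite mulr0 addr0 in hi.
apply: (squeeze_cvgr _ (cvg_cst (0 : R)) hi); apply: nearW => n.
by have /andP[-> _] := threshold_poly01 n y01; rewrite threshold_poly_below ?y0.
Qed.

End threshold.

Section carried.
Variables (R : realType) (mu : {finite_measure set (measurableTypeR R) -> \bar R}).
Hypothesis mu_I : carried_by mu `[-1, 1].

Lemma measurable_sym_itv : measurable (`[-1, 1]%classic : set (measurableTypeR R)).
Proof. by []. Qed.

Lemma carried_measure (A : set (measurableTypeR R)) :
  measurable A -> mu A = mu (A `&` `[-1, 1]).
Proof.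
move=> mA; have mI := measurable_sym_itv.
have mAI : measurable (A `&` `[-1, 1]) by exact: measurableI.
have mAD : measurable (A `\` `[-1, 1]) by exact: measurableD.
have null : mu (A `\` `[-1, 1]) = 0%E.
  apply/eqP; rewrite eq_le measure_ge0 andbT -mu_I.
  by apply: le_measure; rewrite ?inE //; exact: measurableC.
have := measureU mu mAI mAD; rewrite setUIDK => ->.
  by rewrite [X in (_ + X)%E]null adde0.
by rewrite setIACA setICr setI0.
Qed.

Lemma poly_integrable (p : {poly R}) :
  mu.-integrable `[-1, 1] (fun x => (p.[x])%:E).
Proof.
apply: measurable_bounded_integrable => //.
- by rewrite ltey_eq fin_num_measure.
- exact: measurable_poly.
- exists (\sum_(i < size p) `|p`_i|); split; first by rewrite num_real.
  move=> C pC t /= tI; apply: le_trans (ltW pC); apply: horner_norm_le.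
  by rewrite ler_norml; move: tI; rewrite in_itv.
Qed.

(** Dominated convergence: on [-1,1] the polynomials are bounded by 1. *)
Lemma halfline_cvg (t : R) (P : nat -> {poly R}) :
  (forall n x, -1 <= x <= 1 -> 0 <= (P n).[x] <= 1) ->
  (forall x, -1 <= x <= 1 ->
    (P n).[x] @[n --> \oo] --> (if t < x then 1 else 0 : R)) ->
  \int[mu]_(x in `[-1, 1]) (P n).[x] @[n --> \oo] --> fine (mu `]t, +oo[%classic).
Proof.
move=> P01 P_cvg.
have mt : measurable (`]t, +oo[%classic : set (measurableTypeR R)) by [].
have mI := measurable_sym_itv.
rewrite carried_measure // -integral_indic //.
apply: fine_cvg.
rewrite fineK; last first.
  by rewrite integral_indic // fin_num_measure //; exact: measurableI.
have [] // := @dominated_convergence _ _ _ mu _ mI (fun n x => ((P n).[x])%:E)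
  (fun x => (\1_(`]t, +oo[%classic) x)%:E) (cst 1%E).
- by move=> n; apply/measurable_EFinP; exact: measurable_poly.
- by apply/measurable_EFinP; exact: measurable_indic.
- apply: aeW => x xI; apply: cvg_EFin; first exact: nearW.
  have := P_cvg x; rewrite indicE mem_setE /= in_itv /= andbT.
  by move: xI; rewrite /= in_itv /= => -> /(_ isT); case: (t < x).
- exact: finite_measure_integrable_cst.
- apply: aeW => x n; rewrite /= in_itv /= => xI; rewrite lee_fin.
  by have /andP[P0 P1] := P01 n x xI; rewrite ger0_norm.
Qed.

End carried.

Section determinacy.
Variables (R : realType) (I : finType).
Variables (mu : I -> {finite_measure set (measurableTypeR R) -> \bar R}).
Variable r : I -> R.
Hypothesis mu_I : forall i, carried_by (mu i) `[-1, 1].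
Hypothesis moments0 : forall p : {poly R},
  \sum_i r i * \int[mu i]_(x in `[-1, 1]) p.[x] = 0.

Let S (A : set (measurableTypeR R)) : R := \sum_i r i * fine (mu i A).

Lemma combination_total : S setT = 0.
Proof.
rewrite -[RHS](moments0 1); apply: eq_bigr => i _; congr (_ * _).
rewrite (carried_measure (mu_I i)) // setTI.
under eq_Rintegral do rewrite hornerC.
by rewrite Rintegral_cst ?mul1r //; exact: measurable_sym_itv.
Qed.

Lemma combination_halfline t : S `]t, +oo[%classic = 0.
Proof.
have [t2|t2] := leP 2 t.
  rewrite /S big1 // => i _; rewrite (carried_measure (mu_I i)) //.
  rewrite (_ : _ `&` _ = set0) ?measure0 ?mulr0 // -subset0 => x [] /=.
  by rewrite !in_itv /= andbT => tx /andP[_ x1]; lra.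
have [t2'|t2'] := leP t (-2).
  rewrite -combination_total; apply: eq_bigr => i _; congr (_ * fine _).
  rewrite (carried_measure (mu_I i)) // [RHS](carried_measure (mu_I i)) //.
  congr (mu i _); rewrite setTI; apply/setIidPr => x /=.
  by rewrite !in_itv /= andbT => /andP[x1 _]; lra.
(* x |-> (x + 2) / 4 maps [-1,1] into [1/4,3/4], so that every threshold t
   with |t| < 2 falls strictly inside ]0,1[ and end points need no care. *)
pose tau := (t + 2) / 4.
have tau01 : 0 < tau < 1 by rewrite /tau; apply/andP; split; lra.
pose P n := threshold_poly tau n \Po (4^-1 *: ('X + 2%:P)).
have PE n x : (P n).[x] = (threshold_poly tau n).[(x + 2) / 4].
  by rewrite horner_comp !hornerE mulrC.
have unit (x : R) : -1 <= x <= 1 -> 0 <= (x + 2) / 4 <= 1.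
  by move=> /andP[? ?]; apply/andP; split; lra.
have lim : \sum_i r i * \int[mu i]_(x in `[-1, 1]) (P n).[x] @[n --> \oo] -->
    S `]t, +oo[%classic.
  apply: cvg_big => [|i _]; first exact: add_continuous.
  apply: cvgM; first exact: cvg_cst.
  apply: halfline_cvg => // [n x|x] /unit xI.
    by rewrite PE; exact: threshold_poly01.
  under eq_cvg do rewrite PE.
  have := threshold_poly_cvg tau01 xI; rewrite /tau ltr_pM2r ?invr_gt0 //.
  by rewrite ltrD2r.
rewrite (_ : (fun n => _) = cst 0) in lim; last by apply/funext.
exact: (cvg_unique (@Rhausdorff R) lim (cvg_cst 0)).
Qed.

(** Half-lines generate the Borel sets and form a pi-system; the sets on which
    the combination vanishes form a lambda-system. *)
Theorem moment_determinacy (A : set (measurableTypeR R)) :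
  measurable A -> \sum_i r i * fine (mu i A) = 0.
Proof.
pose H := [set B : set (measurableTypeR R) | measurable B /\ S B = 0].
have lamH : lambda_system setT H.
  split=> //.
  - by split; [exact: measurableT|exact: combination_total].
  - move=> B C CB [mB SB] [mC SC]; split; first exact: measurableD.
    rewrite -[RHS](subrr 0) -[in X in X - _]SB -SC /S -sumrB.
    apply: eq_bigr => i _; rewrite -mulrBr; congr (_ * _).
    rewrite measureD ?ltey_eq ?fin_num_measure //.
    by rewrite (setIidr CB) fineB ?fin_num_measure.
  - move=> F F_nd HF.
    have mF n : measurable (F n) by have [] := HF n.
    have mU : measurable (\bigcup_n F n) by exact: bigcup_measurable.
    split=> //.
    have lim : S (F n) @[n --> \oo] --> S (\bigcup_n F n).
      apply: cvg_big => [|i _]; first exact: add_continuous.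
      apply: cvgM; first exact: cvg_cst.
      apply: fine_cvg; rewrite fineK ?fin_num_measure //.
      exact: nondecreasing_cvg_mu.
    rewrite (_ : (fun n => _) = cst 0) in lim; last first.
      by apply/funext => n; exact: (HF n).2.
    exact: (cvg_unique (@Rhausdorff R) lim (cvg_cst 0)).
move=> mA; suff [] : H A by [].
have GI : setI_closed (@RGenOInfty.G R).
  move=> _ _ [x ->] [y ->]; exists (Num.max x y).
  by apply/seteqP; split=> z /=; rewrite !in_itv /= !andbT gt_max => /andP.
apply: (lambda_system_subset GI lamH) => //.
  by move=> _ [t ->]; split; [|exact: combination_halfline].
have := RGenOInfty.measurableE R.
rewrite /measurable /= => <-.
exact: mA.
Qed.

End determinacy.


(** * Charges that are differences of measures *)

Lemma poly_integrableT (R : realType)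
    (mu : {finite_measure set (measurableTypeR R) -> \bar R}) (p : {poly R}) :
  carried_by mu `[-1, 1] -> mu.-integrable setT (fun x => (p.[x])%:E).
Proof.
move=> mu_I; have mI := @measurable_sym_itv R.
have mCI : measurable (~` (`[-1, 1]%classic : set (measurableTypeR R))).
  exact: measurableC.
have mp : measurable_fun setT (fun x : measurableTypeR R => (p.[x])%:E).
  by apply/measurable_EFinP; exact: measurable_poly.
apply/(negligible_integrable mCI measurableT mp mu_I).
by rewrite setDE setCK setTI; exact: poly_integrable.
Qed.

Section charge_difference.
Variables (R : realType) (mu1 mu2 : {finite_measure set (measurableTypeR R) -> \bar R}).
Hypothesis mu1_I : carried_by mu1 `[-1, 1].
Hypothesis mu2_I : carried_by mu2 `[-1, 1].

Definition charge_difference : signed_measure_on R :=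
  cadd (charge_of_finite_measure mu1) (copp (charge_of_finite_measure mu2)).

Local Notation nu := charge_difference.

Lemma charge_differenceE A : nu A = (mu1 A - mu2 A)%E.
Proof. by []. Qed.

Let P := projT1 (cid (charge_hahn nu)).
Let hahn : hahn_decomposition nu P.1 P.2 := projT2 (cid (charge_hahn nu)).
Let pos : {finite_measure set (measurableTypeR R) -> \bar R} := jordan_pos hahn.
Let neg : {finite_measure set (measurableTypeR R) -> \bar R} := jordan_neg hahn.

Lemma charge_difference_null (A : set (measurableTypeR R)) : measurable A ->
  A `<=` ~` `[-1, 1]%classic -> nu A = 0%E.
Proof.
move=> mA AI; rewrite charge_differenceE.
have null (mu : {finite_measure set (measurableTypeR R) -> \bar R}) :
    carried_by mu `[-1, 1] -> mu A = 0%E.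
  move=> muI; rewrite (carried_measure muI) // (_ : _ `&` _ = set0) ?measure0 //.
  by rewrite -subset0 => x [/AI].
by rewrite !null // subee.
Qed.

Lemma charge_pos_carried : carried_by pos `[-1, 1].
Proof.
have mI : measurable (~` (`[-1, 1]%classic : set (measurableTypeR R))).
  exact: measurableC.
have [[mP _] _ _ _] := hahn.
rewrite /carried_by /pos /= jordan_posE cjordan_posE /crestr0 mem_set //.
by rewrite /crestr charge_difference_null //; exact: measurableI.
Qed.

Lemma charge_neg_carried : carried_by neg `[-1, 1].
Proof.
have mI : measurable (~` (`[-1, 1]%classic : set (measurableTypeR R))).
  exact: measurableC.
have [_ [mN _] _ _] := hahn.
rewrite /carried_by /neg /= jordan_negE cjordan_negE /crestr0 mem_set //.
by rewrite /crestr charge_difference_null ?oppe0 //; exact: measurableI.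
Qed.

Lemma charge_pos_integrable (p : {poly R}) :
  (charge_pos nu).-integrable setT (fun x : R => (p.[x])%:E).
Proof. exact: poly_integrableT charge_pos_carried. Qed.

Lemma charge_neg_integrable (p : {poly R}) :
  (charge_neg nu).-integrable setT (fun x : R => (p.[x])%:E).
Proof. exact: poly_integrableT charge_neg_carried. Qed.

(** The Jordan parts of mu1 - mu2 need not be mu1 and mu2, but
    pos + mu2 = neg + mu1 as measures, and integrals are additive in the
    measure. *)
Lemma charge_integral_difference (p : {poly R}) :
  charge_integral nu `[-1, 1] (horner p) =
  \int[mu1]_(x in `[-1, 1]) p.[x] - \int[mu2]_(x in `[-1, 1]) p.[x].
Proof.
have mI := @measurable_sym_itv R.
have fin (m : {finite_measure set (measurableTypeR R) -> \bar R}) :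
    (\int[m]_(x in `[(-1)%R, 1%R]) (p.[x])%:E)%E \is a fin_num.
  by apply: integrable_fin_num => //; exact: poly_integrable.
have E : (\int[pos]_(x in `[(-1)%R, 1%R]) (p.[x])%:E +
    \int[mu2]_(x in `[(-1)%R, 1%R]) (p.[x])%:E =
    \int[neg]_(x in `[(-1)%R, 1%R]) (p.[x])%:E +
    \int[mu1]_(x in `[(-1)%R, 1%R]) (p.[x])%:E)%E.
  rewrite -!integral_measure_add //; try exact: poly_integrable.
  apply: eq_measure_integral => A mA _.
  transitivity (pos A + mu2 A)%E; first exact: measure_addE.
  transitivity (neg A + mu1 A)%E; last exact/esym/measure_addE.
  have := jordan_decomp hahn mA; rewrite charge_differenceE /cadd /= cscaleN1.
  have := fin_num_measure mu1 A mA; have := fin_num_measure mu2 A mA.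
  have := fin_num_measure pos A mA; have := fin_num_measure neg A mA.
  rewrite /pos /neg /=.
  move: (jordan_pos _ _) (jordan_neg _ _) (mu1 A) (mu2 A).
  move=> [x| |] [y| |] [z| |] [t| |] //= _ _ _ _ [xyzt].
  by rewrite -!EFinD; congr EFin; lra.
move: E; rewrite -(fineK (fin pos)) -(fineK (fin neg)).
rewrite -(fineK (fin mu1)) -(fineK (fin mu2)) -!EFinD => -[E].
rewrite /charge_integral /Rintegral.
apply/eqP; rewrite subr_eq addrAC eq_sym subr_eq; apply/eqP.
by rewrite [LHS]addrC -[LHS]E addrC.
Qed.
End charge_difference.


(** * Functionals given by moment sequences *)

Section coef_functional.
Variable R : realType.
Implicit Types (s : nat -> R) (p q : {poly R}).

(** The linear functional whose moment sequence is s. *)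
Definition coef_functional s p : R^o := \sum_(i < size p) p`_i * s i.

Lemma coef_functional_widen s p n : (size p <= n)%N ->
  coef_functional s p = \sum_(i < n) p`_i * s i.
Proof.
move=> /subnKC <-; rewrite big_split_ord /= [X in _ + X]big1 ?addr0 // => i _.
by rewrite nth_default ?mul0r // leq_addr.
Qed.

Lemma coef_functional_scalar s : scalar (coef_functional s).
Proof.
move=> k p q; pose n := maxn (size (k *: p + q)) (maxn (size p) (size q)).
rewrite !(@coef_functional_widen _ _ n) ?leq_max ?leqnn ?orbT //.
rewrite mulr_sumr -big_split; apply: eq_bigr => i _ /=.
by rewrite coefD coefZ mulrDl mulrA.
Qed.

HB.instance Definition _ s := GRing.isLinear.Build R {poly R} R^o _
  (coef_functional s) (coef_functional_scalar s).

Lemma coef_functionalC s c : coef_functional s c%:P = c * s 0%N.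
Proof.
rewrite (@coef_functional_widen _ _ 1) ?size_polyC_leq1 //.
by rewrite big_ord_recl big_ord0 addr0 coefC.
Qed.

Lemma coef_functionalXM s p :
  coef_functional s ('X * p) = coef_functional (fun i => s i.+1) p.
Proof.
rewrite (@coef_functional_widen _ _ (size p).+1); last first.
  by apply: (leq_trans (size_polyMleq _ _)); rewrite size_polyX.
rewrite big_ord_recl coefXM /= mul0r add0r; apply: eq_bigr => i _.
by rewrite coefXM.
Qed.

Lemma eq_coef_functional s t p : (forall i, (i < size p)%N -> s i = t i) ->
  coef_functional s p = coef_functional t p.
Proof. by move=> st; apply: eq_bigr => i _; rewrite st. Qed.

Lemma coef_functional_sum (I : finType) (s : I -> nat -> R) p :
  coef_functional (fun i => \sum_j s j i) p = \sum_j coef_functional (s j) p.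
Proof.
by rewrite exchange_big; apply: eq_bigr => i _; rewrite mulr_sumr.
Qed.

Lemma coef_functional_mulr s c p :
  coef_functional (fun i => s i * c) p = coef_functional s p * c.
Proof. by rewrite mulr_suml; apply: eq_bigr => i _; rewrite mulrA. Qed.

Lemma coef_functional_add s t p :
  coef_functional (fun i => s i + t i) p = coef_functional s p + coef_functional t p.
Proof. by rewrite -big_split; apply: eq_bigr => i _; rewrite mulrDr. Qed.

Lemma coef_functionalM s p q : coef_functional s (p * q) =
  coef_functional (fun i => coef_functional (fun j => s (i + j)%N) q) p.
Proof.
elim/poly_ind: p s => [|p c IH] s; first by rewrite mul0r !linear0.
rewrite mulrDl !linearD /= mul_polyC linearZ /= coef_functionalC.
by rewrite mulrAC ![_ * 'X]mulrC !coef_functionalXM IH.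
Qed.

End coef_functional.


(** * Reversible block tridiagonal kernels *)

Section reversible_kernel.
Variables (R : realType) (N : nat).
Variables (A C : nat -> 'I_N -> R) (B : nat -> 'I_N -> 'I_N -> R).
Variable w : nat -> 'I_N -> R.
Hypothesis w_gt0 : forall n i, 0 < w n i.
Hypothesis A_gt0 : forall n i, 0 < A n i.
Hypothesis B_ge0 : forall n i j, 0 <= B n i j.
Hypothesis row_le1 : forall n i,
  A n i + \sum_j B n i j + (if n is 0 then 0 else C n i) <= 1.
Hypothesis balance_AC : forall n i, w n i * A n i = w n.+1 i * C n.+1 i.
Hypothesis balance_B : forall n i j, w n i * B n i j = w n j * B n j i.

Local Notation vec := (nat -> 'I_N -> R).
Implicit Types f g : vec.

(** A vector f holds the coordinates f(n,i) of a combination of states, and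
    push is the action f |-> f P of the block tridiagonal matrix P with
    off-diagonal blocks diag (A n), diag (C n) and diagonal blocks B n. *)
Definition push f : vec := fun n i =>
  \sum_j f n j * B n j i + f n.+1 i * C n.+1 i
  + (if n is n'.+1 then f n' i * A n' i else 0).

Definition unit_vec n i : vec := fun m j => ((m == n) && (j == i))%:R.

(** Truncated to the blocks below K, which loses nothing on vectors
    that vanish from block K on. *)
Definition dot K f g := \sum_(n < K) \sum_i f n i * g n i / w n i.

Definition vanishes_from K f := forall n i, (K <= n)%N -> f n i = 0.

Lemma push_vanishes K f : vanishes_from K f -> vanishes_from K.+1 (push f).
Proof.
move=> fK [|n] i; first by [].
rewrite ltnS => Kn; rewrite /push big1 ?add0r => [|j _]; last first.
  by rewrite fK ?mul0r // ltnW.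
by rewrite !fK ?mul0r ?addr0 // leqW ?leqW.
Qed.

Lemma iter_push_vanishes K f m :
  vanishes_from K f -> vanishes_from (m + K) (iter m push f).
Proof. by move=> fK; elim: m => // m IH; exact: push_vanishes. Qed.

Lemma unit_vec_vanishes n i : vanishes_from n.+1 (unit_vec n i).
Proof. by move=> m j nm; rewrite /unit_vec gtn_eqF. Qed.

Lemma dot_unit_vec K f n i : (n < K)%N -> dot K f (unit_vec n i) = f n i / w n i.
Proof.
move=> nK; rewrite /dot (bigD1 (Ordinal nK)) //= [X in _ + X]big1 ?addr0.
  rewrite (bigD1 i) //= [X in _ + X]big1 ?addr0 => [|j /negbTE ji].
    by rewrite /unit_vec !eqxx mulr1.
  by rewrite /unit_vec ji andbF mulr0 mul0r.
move=> m; rewrite -val_eqE /= => /negbTE mn; rewrite big1 // => j _.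
by rewrite /unit_vec mn mulr0 mul0r.
Qed.

(** In the densities f / w, detailed balance makes the part between neighbouring
    blocks manifestly symmetric in f and g. *)
Lemma dot_pushE K f g : vanishes_from K f -> vanishes_from K g ->
  dot K.+1 (push f) g =
  \sum_(n < K.+1) \sum_i \sum_j w n j * B n j i * (f n j / w n j) * (g n i / w n i)
  + \sum_(n < K.+1) \sum_i w n i * A n i *
      (f n.+1 i / w n.+1 i * (g n i / w n i) + g n.+1 i / w n.+1 i * (f n i / w n i)).
Proof.
move=> fK gK; have wn0 n i : w n i != 0 by rewrite gt_eqF.
have -> : dot K.+1 (push f) g =
    \sum_(n < K.+1) \sum_i \sum_j w n j * B n j i * (f n j / w n j) * (g n i / w n i)
    + \sum_(n < K.+1) \sum_i w n i * A n i * (f n.+1 i / w n.+1 i * (g n i / w n i))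
    + \sum_(n < K.+1) \sum_i (if (n : nat) is n'.+1 then f n' i * A n' i else 0) * g n i / w n i.
  rewrite -!big_split; apply: eq_bigr => n _; rewrite -!big_split /=.
  apply: eq_bigr => i _; rewrite /push !mulrDl; congr (_ + _ + _).
    by rewrite !mulr_suml; apply: eq_bigr => j _; field; rewrite !wn0.
  by rewrite balance_AC; field; rewrite !wn0.
rewrite -addrA; congr (_ + _).
rewrite [X in _ + X = _]big_ord_recl /= [X in _ + (X + _) = _]big1; last first.
  by move=> i _; rewrite !mul0r.
rewrite add0r.
under [RHS]eq_bigr do under eq_bigr do rewrite mulrDr.
under [RHS]eq_bigr do rewrite big_split /=.
rewrite big_split /=; congr (_ + _).
rewrite [RHS]big_ord_recr /= [X in _ + X]big1 ?addr0 => [|i _]; last first.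
  by rewrite gK // !mul0r mulr0.
apply: eq_bigr => n _; apply: eq_bigr => i _; rewrite /bump /= add1n.
by field; rewrite !wn0.
Qed.

Lemma dot_push_sym K f g : vanishes_from K f -> vanishes_from K g ->
  dot K.+1 (push f) g = dot K.+1 f (push g).
Proof.
move=> fK gK; have dotC f' g' : dot K.+1 f' g' = dot K.+1 g' f'.
  by apply: eq_bigr => n _; apply: eq_bigr => i _; rewrite (mulrC (f' _ _)).
rewrite [RHS]dotC !dot_pushE //; congr (_ + _); apply: eq_bigr => n _.
  rewrite exchange_big; apply: eq_bigr => i _; apply: eq_bigr => j _ /=.
  by rewrite balance_B mulrAC.
by apply: eq_bigr => i _; rewrite addrC.
Qed.

Lemma two_mul_le (c x y : R) : 0 <= c -> `|c * (x * y *+ 2)| <= c * (x ^+ 2 + y ^+ 2).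
Proof.
move=> c0; rewrite normrM ger0_norm // ler_wpM2l // ler_norml.
have := sqr_ge0 (x + y); have := sqr_ge0 (x - y).
by rewrite sqrrB sqrrD => ? ?; apply/andP; split; lra.
Qed.

(** Each conductance k(s,t) = w(s) P(s,t) contributes at most
    k(s,t) (h(s)^2 + h(t)^2) / 2 to the form, where h = f / w; summing over t
    and using that rows sum to at most 1 leaves the sum of the w(s) h(s)^2. *)
Lemma push_contraction K f : vanishes_from K f ->
  `|dot K.+1 (push f) f| <= dot K.+1 f f.
Proof.
move=> fK; have wn0 n i : w n i != 0 by rewrite gt_eqF.
pose h n i := f n i / w n i.
have hK : forall n i, (K <= n)%N -> h n i = 0 by move=> n i Kn; rewrite /h fK ?mul0r.
rewrite (dot_pushE fK fK) (le_trans (ler_normD _ _)) //.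
have bB : `|\sum_(n < K.+1) \sum_i \sum_j w n j * B n j i * h n j * h n i| <=
    \sum_(n < K.+1) \sum_i (\sum_j B n i j) * (w n i * h n i ^+ 2).
  rewrite (le_trans (ler_norm_sum _ _ _)) //; apply: ler_sum => n _.
  apply: (@le_trans _ _ (\sum_i \sum_j
      w n j * B n j i * (h n j ^+ 2 / 2 + h n i ^+ 2 / 2))).
    rewrite (le_trans (ler_norm_sum _ _ _)) //; apply: ler_sum => i _.
    rewrite (le_trans (ler_norm_sum _ _ _)) //; apply: ler_sum => j _.
    have c0 : 0 <= w n j * B n j i / 2.
      by rewrite divr_ge0 // mulr_ge0 // ltW.
    have := two_mul_le (h n j) (h n i) c0; move: (h n j) (h n i) => x y.
    by congr (`|_| <= _); field.
  under [leLHS]eq_bigr do under eq_bigr do rewrite mulrDr.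
  under [leLHS]eq_bigr do rewrite big_split /=.
  rewrite big_split /= [X in X + _ <= _]exchange_big /=.
  rewrite -big_split /=; apply: ler_sum => i _.
  rewrite -big_split /= mulr_suml; apply: ler_sum => j _.
  by rewrite (balance_B n j i) le_eqVlt; apply/orP; left; apply/eqP; field.
have bA : `|\sum_(n < K.+1) \sum_i w n i * A n i *
      (h n.+1 i * h n i + h n.+1 i * h n i)| <=
    \sum_(n < K.+1) \sum_i A n i * (w n i * h n i ^+ 2) +
    \sum_(n < K.+1) \sum_i (if (n : nat) is 0 then 0 else C n i) * (w n i * h n i ^+ 2).
  apply: (@le_trans _ _ (\sum_(n < K.+1) \sum_i (A n i * (w n i * h n i ^+ 2) +
      C n.+1 i * (w n.+1 i * h n.+1 i ^+ 2)))).
    rewrite (le_trans (ler_norm_sum _ _ _)) //; apply: ler_sum => n _.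
    rewrite (le_trans (ler_norm_sum _ _ _)) //; apply: ler_sum => i _.
    have c0 : 0 <= w n i * A n i by rewrite mulr_ge0 ?ltW.
    rewrite -mulr2n; apply: le_trans (two_mul_le _ _ c0) _.
    rewrite mulrDr {1}balance_AC le_eqVlt; apply/orP; left; apply/eqP; ring.
  under eq_bigr do rewrite big_split /=.
  rewrite big_split /= lerD2l big_ord_recr /= [X in _ + X]big1 ?addr0; last first.
    by move=> i _; rewrite hK // expr0n /= !mulr0.
  rewrite [leRHS]big_ord_recl /= [X in _ <= X + _]big1 ?add0r //.
  by move=> i _; rewrite mul0r.
apply: (le_trans (lerD bB bA)); rewrite -!big_split /=; apply: ler_sum => n _.
rewrite -!big_split /=; apply: ler_sum => i _.
have -> : f n i * f n i / w n i = w n i * h n i ^+ 2.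
  by rewrite /h; field; rewrite wn0.
rewrite -!mulrDl -[leRHS]mul1r ler_wpM2r //.
  by rewrite mulr_ge0 ?sqr_ge0 // ltW.
by rewrite addrA [X in X + _]addrC; exact: row_le1.
Qed.

Lemma vanishes_fromW K K' f : (K <= K')%N -> vanishes_from K f -> vanishes_from K' f.
Proof. by move=> KK' fK n i K'n; apply: fK; exact: leq_trans K'n. Qed.

(** The vector e_k P^a. *)
Definition orbit k a : vec := iter a push (unit_vec 0 k).

Lemma orbit_vanishes k a : vanishes_from a.+1 (orbit k a).
Proof. by rewrite -addn1; exact/iter_push_vanishes/unit_vec_vanishes. Qed.

(** The number <e_k P^a, e_l>, moment of order a of the spectral measure
    W_kl. *)
Definition moment k l (a : nat) : R := orbit k a 0%N l / w 0%N l.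

(** Symmetry of the kernel moves all powers to the left factor. *)
Lemma dot_orbit K k l a b : (a + b < K)%N ->
  dot K (orbit k a) (orbit l b) = moment k l (a + b).
Proof.
elim: b a => [|b IH] a abK.
  by rewrite addn0 dot_unit_vec //; case: (K) abK.
case: K abK IH => // K; rewrite addnS ltnS => abK IH.
rewrite /= -dot_push_sym; first by rewrite -addSn -(IH a.+1) // addSn ltnS.
  by apply: vanishes_fromW (@orbit_vanishes k a); apply: leq_trans abK; lia.
by apply: vanishes_fromW (@orbit_vanishes l b); apply: leq_trans abK; lia.
Qed.

(** The sum over k of the vectors e_k F_k(P). *)
Definition coord (F : 'I_N -> {poly R}) : vec := fun n i =>
  \sum_k coef_functional (fun a => orbit k a n i) (F k).

Lemma coord_vanishes (F : 'I_N -> {poly R}) D : (forall k, (size (F k) <= D)%N) ->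
  vanishes_from D (coord F).
Proof.
move=> FD n i Dn; rewrite /coord big1 // => k _.
rewrite (@eq_coef_functional _ _ (fun=> 0)) => [|a aF].
  by rewrite /coef_functional big1 // => a _; rewrite mulr0.
by apply: orbit_vanishes; apply: leq_trans Dn; exact: leq_trans (FD k).
Qed.

Lemma coordX (F : 'I_N -> {poly R}) n i :
  coord (fun k => 'X * F k) n i = push (coord F) n i.
Proof.
rewrite /push /coord; under eq_bigr do rewrite coef_functionalXM.
under [X in _ = X + _ + _]eq_bigr do rewrite mulr_suml.
have -> : (if n is n'.+1 then
    (\sum_k coef_functional (fun a => orbit k a n' i) (F k)) * A n' i else 0) =
    \sum_k coef_functional
      (fun a => if n is n'.+1 then orbit k a n' i * A n' i else 0) (F k).
  case: n => [|n].
    by rewrite big1 // => k _; rewrite /coef_functional big1 // => a _; rewrite mulr0.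
  by rewrite mulr_suml; apply: eq_bigr => k _; rewrite coef_functional_mulr.
rewrite [X in _ = X + _ + _]exchange_big mulr_suml -!big_split /=.
apply: eq_bigr => k _; rewrite -coef_functional_mulr.
under [X in _ = X + _ + _]eq_bigr do rewrite -coef_functional_mulr.
by rewrite -coef_functional_sum -!coef_functional_add.
Qed.

Definition moment_functional k l := coef_functional (moment k l).

Lemma dot_orbit_sum K k l (p q : {poly R}) :
  coef_functional (fun a =>
    coef_functional (fun b => dot K (orbit k a) (orbit l b)) q) p =
  \sum_(n < K) \sum_i coef_functional (fun a => orbit k a n i) p *
    coef_functional (fun b => orbit l b n i) q / w n i.
Proof.
transitivity (coef_functional (fun a => \sum_(n < K) \sum_i
    orbit k a n i * (coef_functional (fun b => orbit l b n i) q / w n i)) p).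
  apply: eq_coef_functional => a _; rewrite /dot coef_functional_sum.
  apply: eq_bigr => n _; rewrite coef_functional_sum; apply: eq_bigr => i _.
  rewrite -coef_functional_mulr mulrC -coef_functional_mulr.
  by apply: eq_coef_functional => b _; rewrite [RHS]mulrC mulrA.
rewrite coef_functional_sum; apply: eq_bigr => n _.
rewrite coef_functional_sum; apply: eq_bigr => i _.
by rewrite coef_functional_mulr mulrA.
Qed.

(** Polynomial calculus: <F(P), G(P)> is the integral of F dW G^T. *)
Lemma dot_coord (F G : 'I_N -> {poly R}) K D : (forall k, (size (F k) <= D)%N) ->
  (forall k, (size (G k) <= D)%N) -> (D + D <= K)%N ->
  dot K (coord F) (coord G) = \sum_k \sum_l moment_functional k l (F k * G l).
Proof.
move=> FD GD DK.
transitivity (\sum_k \sum_l coef_functional (fun a =>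
    coef_functional (fun b => dot K (orbit k a) (orbit l b)) (G l)) (F k)).
  under [RHS]eq_bigr do under eq_bigr do rewrite dot_orbit_sum.
  under [RHS]eq_bigr do rewrite exchange_big /=.
  rewrite [RHS]exchange_big; apply: eq_bigr => n _ /=.
  under [RHS]eq_bigr do rewrite exchange_big /=.
  rewrite [RHS]exchange_big; apply: eq_bigr => i _ /=.
  rewrite /coord !mulr_suml; apply: eq_bigr => k _.
  by rewrite mulr_sumr mulr_suml.
apply: eq_bigr => k _; apply: eq_bigr => l _.
rewrite /moment_functional coef_functionalM.
apply: eq_coef_functional => a aF; apply: eq_coef_functional => b bG.
rewrite dot_orbit //; apply: leq_trans DK; move: (FD k) (GD l); lia.
Qed.

Lemma moment_functional_sym k l : moment_functional k l =1 moment_functional l k.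
Proof.
move=> p; apply: eq_coef_functional => a _.
have := @dot_orbit a.+1 k l a 0; rewrite addn0 => <- //.
have := @dot_orbit a.+1 l k 0 a; rewrite add0n => <- //.
by apply: eq_bigr => n _; apply: eq_bigr => i _; rewrite [orbit k _ _ _ * _]mulrC.
Qed.

(** The contraction inequality for the vector of F: it is what |x| <= 1 on the
    support of W amounts to for the moments. *)
Lemma moment_functional_contraction (F : 'I_N -> {poly R}) :
  `|\sum_k \sum_l moment_functional k l ('X * (F k * F l))| <=
  \sum_k \sum_l moment_functional k l (F k * F l).
Proof.
pose D := \max_k size (F k).
have FD k : (size (F k) <= D)%N by exact: (leq_bigmax k).
have XFD k : (size ('X * F k)%R <= D.+1)%N.
  by apply: (leq_trans (size_polyMleq _ _)); rewrite size_polyX ltnS.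
have FD1 k : (size (F k) <= D.+1)%N by exact: leqW.
pose K := (D.+1 + D.+1)%N.
have fK : vanishes_from K (coord F).
  by apply: vanishes_fromW (coord_vanishes FD); rewrite /K; lia.
have := push_contraction fK.
rewrite (@dot_coord F F K.+1 D.+1) //.
have -> : push (coord F) = coord (fun k => 'X * F k).
  by apply/funext => n; apply/funext => i; rewrite coordX.
rewrite (@dot_coord (fun k => 'X * F k) F K.+1 D.+1) //.
by under [X in `|X|]eq_bigr do under eq_bigr do rewrite -mulrA.
Qed.

Lemma push_unit_vec n i m j : push (unit_vec n i) m j =
  A n i * unit_vec n.+1 i m j + \sum_l B n i l * unit_vec n l m j
  + (if n is n'.+1 then C n i * unit_vec n' i m j else 0).
Proof.
have EB : \sum_l unit_vec n i m l * B m l j = \sum_l B n i l * unit_vec n l m j.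
  rewrite (bigD1 i) //= [RHS](bigD1 j) //= !big1 ?addr0 => [|l|l].
  - rewrite /unit_vec !eqxx !andbT mulrC.
    by case: eqP => [->|] //; rewrite !mulr0.
  - by rewrite /unit_vec eq_sym => /negbTE ->; rewrite andbF mulr0.
  - by rewrite /unit_vec => /negbTE ->; rewrite andbF mul0r.
have EC : unit_vec n i m.+1 j * C m.+1 j =
    if n is n'.+1 then C n i * unit_vec n' i m j else 0.
  rewrite /unit_vec; case: n {EB} => [|n]; first by rewrite mul0r.
  rewrite eqSS mulrC; case: eqP => [->|] /=; last by rewrite !mulr0.
  by case: eqP => [->|] //=; rewrite !mulr0.
have EA : (if m is m'.+1 then unit_vec n i m' j * A m' j else 0) =
    A n i * unit_vec n.+1 i m j.
  rewrite /unit_vec; case: m {EB EC} => [|m]; first by rewrite mulr0.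
  rewrite eqSS mulrC; case: eqP => [->|] /=; last by rewrite !mulr0.
  by case: eqP => [->|] //=; rewrite !mulr0.
by rewrite /push EB EC EA addrC addrA.
Qed.

Section orthogonality.
Variable Q : nat -> 'I_N -> 'I_N -> {poly R}.
Hypothesis Q0 : forall i k, Q 0 i k = (i == k)%:R.
Hypothesis QS : forall n i k, 'X * Q n i k =
  A n i *: Q n.+1 i k + \sum_j B n i j *: Q n j k
  + (if n is n'.+1 then C n i *: Q n' i k else 0).

(** The unit vectors obey under push the recurrence that defines Q under
    multiplication by x, and A n i <> 0 lets both be solved for the next
    block. *)
Lemma coord_matrix_polynomial n i m j : coord (Q n i) m j = unit_vec n i m j.
Proof.
elim/ltn_ind: n i m j => -[_|n IH] i m j.
  rewrite /coord (bigD1 i) //= big1 ?addr0 => [|k].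
    by rewrite Q0 eqxx -polyC1 coef_functionalC mul1r.
  by rewrite eq_sym => /negbTE ik; rewrite Q0 ik mulr0n linear0.
have pushQ : push (coord (Q n i)) m j = push (unit_vec n i) m j.
  by congr (push _ m j); apply/funext => m'; apply/funext => j'; exact: IH.
move: pushQ; rewrite -coordX push_unit_vec /coord.
under eq_bigr do rewrite QS !linearD linear_sum linearZ /=.
rewrite !big_split /= -mulr_sumr exchange_big /=.
have -> : \sum_l \sum_k coef_functional (fun a => orbit k a m j) (B n i l *: Q n l k)
    = \sum_l B n i l * unit_vec n l m j.
  apply: eq_bigr => l _; rewrite -IH // mulr_sumr.
  by apply: eq_bigr => k _; rewrite linearZ.
have -> : \sum_k coef_functional (fun a => orbit k a m j)
      (if n is n'.+1 then C n i *: Q n' i k else 0)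
    = (if n is n'.+1 then C n i * unit_vec n' i m j else 0).
  case: n IH => [|n] IH; first by rewrite big1 // => k _; rewrite linear0.
  rewrite -IH ?mulr_sumr //; first by apply: eq_bigr => k _; rewrite linearZ.
by move=> /addIr /addIr /mulfI; apply; rewrite gt_eqF.
Qed.

Lemma moment_orthogonality n m i j :
  \sum_k \sum_l moment_functional k l (Q n i k * Q m j l) =
  ((n == m) && (i == j))%:R / w n i.
Proof.
pose D := (\max_k size (Q n i k) + \max_k size (Q m j k))%N.
rewrite -(@dot_coord (Q n i) (Q m j) (D + D + n + m).+1 D); first last.
- by rewrite leqW // -addnA leq_addr.
- by move=> k; apply: leq_trans (leq_addl _ _); exact: (leq_bigmax k).
- by move=> k; apply: leq_trans (leq_addr _ _); exact: (leq_bigmax k).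
have -> : coord (Q m j) = unit_vec m j.
  by apply/funext => ?; apply/funext => ?; exact: coord_matrix_polynomial.
rewrite dot_unit_vec; last by rewrite ltnS leq_addl.
rewrite coord_matrix_polynomial /unit_vec.
case: eqP => [->|nm]; last by rewrite (introF eqP (fun e => nm (esym e))) !mul0r.
rewrite eqxx /= [j == i]eq_sym.
by case: eqP => [->|] //; rewrite !mul0r.
Qed.

End orthogonality.
End reversible_kernel.

(** If k + l is odd, the product is a square times 1 + x or 1 - x. Otherwise
    multiply by ((1 + x) + (1 - x)) / 2 = 1 to reach two odd cases. *)
Lemma functional_ge0_of_squares (R : realType) (L : {scalar {poly R}}) :
  (forall p, 0 <= L (p * p * (1 + 'X))) -> (forall p, 0 <= L (p * p * (1 - 'X))) ->
  forall k l, 0 <= L ((1 + 'X) ^+ k * (1 - 'X) ^+ l).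
Proof.
move=> Lp Lm; set a : {poly R} := 1 + 'X; set b : {poly R} := 1 - 'X.
have odd_case k l : odd (k + l) -> 0 <= L (a ^+ k * b ^+ l).
  move=> kl; pose c := a ^+ k./2 * b ^+ l./2.
  have -> : a ^+ k * b ^+ l = c * c * (if odd k then a else b).
    rewrite -{1}(odd_double_half k) -{1}(odd_double_half l) !exprD -!addnn !exprD.
    rewrite /c; move: kl; rewrite oddD; case: (odd k); case: (odd l) => //= _;
      rewrite ?expr0 ?expr1; ring.
  by case: ifP => _; [exact: Lp|exact: Lm].
move=> k l; have [//|kl] := boolP (odd (k + l)); first exact: odd_case.
have -> : a ^+ k * b ^+ l = 2^-1 *: (a ^+ k.+1 * b ^+ l + a ^+ k * b ^+ l.+1).
  have -> : a ^+ k.+1 * b ^+ l + a ^+ k * b ^+ l.+1 = 2 *: (a ^+ k * b ^+ l).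
    by rewrite !exprS scaler_nat /a /b; ring.
  by rewrite scalerA mulVf ?scale1r ?pnatr_eq0.
rewrite linearZ linearD /= mulr_ge0 ?invr_ge0 // addr_ge0 // odd_case //.
by rewrite addnS.
Qed.


(** * The matrix moment problem *)

Lemma moment_unique (R : realType)
    (mu nu : {finite_measure set (measurableTypeR R) -> \bar R}) :
  carried_by mu `[-1, 1] -> carried_by nu `[-1, 1] ->
  (forall p : {poly R},
    \int[mu]_(x in `[-1, 1]) p.[x] = \int[nu]_(x in `[-1, 1]) p.[x]) ->
  forall A : set (measurableTypeR R), measurable A -> fine (mu A) = fine (nu A).
Proof.
move=> muI nuI mE A mA; apply/eqP; rewrite -subr_eq0; apply/eqP.
have := @moment_determinacy R bool (fun b => if b then mu else nu)
  (fun b => if b then 1 else -1) _ _ A mA.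
rewrite big_bool /= mul1r mulN1r; apply; first by case.
by move=> p; rewrite big_bool /= mE mul1r mulN1r subrr.
Qed.

Section matrix_moment_problem.
Variables (R : realType) (N : nat) (L : 'I_N -> 'I_N -> {scalar {poly R}}).

Definition quadratic_functional (v : 'I_N -> R) (p : {poly R}) : R^o :=
  \sum_i \sum_j v i * v j * L i j p.

Lemma quadratic_functional_scalar v : scalar (quadratic_functional v).
Proof.
move=> k p q; rewrite /quadratic_functional mulr_sumr -big_split.
apply: eq_bigr => i _; rewrite mulr_sumr -big_split; apply: eq_bigr => j _ /=.
by rewrite linearP /= mulrDr mulrCA.
Qed.

HB.instance Definition _ v := GRing.isLinear.Build R {poly R} R^o _
  (quadratic_functional v) (quadratic_functional_scalar v).

Hypothesis L_sym : forall i j p, L i j p = L j i p.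
Hypothesis L_ge0 : forall v k l,
  0 <= quadratic_functional v ((1 + 'X) ^+ k * (1 - 'X) ^+ l).

Let mu v := projT1 (cid (hausdorff_moment (L_ge0 v))).
Let mu_I v : carried_by (mu v) `[-1, 1] :=
  (projT2 (cid (hausdorff_moment (L_ge0 v)))).1.
Let mu_moment v (p : {poly R}) :
  \int[mu v]_(x in `[-1, 1]) p.[x] = quadratic_functional v p :=
  (projT2 (cid (hausdorff_moment (L_ge0 v)))).2 p.

Let half_sum (i j : 'I_N) (k : 'I_N) : R := ((k == i)%:R + (k == j)%:R) / 2.
Let half_diff (i j : 'I_N) (k : 'I_N) : R := ((k == i)%:R - (k == j)%:R) / 2.

Let W : matrix_measure R N := fun i j =>
  charge_difference (mu (half_sum i j)) (mu (half_diff i j)).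

Let sum_delta (F : 'I_N -> R) i : \sum_k (k == i)%:R * F k = F i.
Proof.
rewrite (bigD1 i) //= eqxx mul1r big1 ?addr0 // => k /negbTE ->.
by rewrite mul0r.
Qed.

Lemma polarization i j p :
  quadratic_functional (half_sum i j) p - quadratic_functional (half_diff i j) p
  = L i j p.
Proof.
transitivity (2^-1 * (\sum_k (k == i)%:R * \sum_l (l == j)%:R * L k l p) +
    2^-1 * (\sum_k (k == j)%:R * \sum_l (l == i)%:R * L k l p)).
  rewrite !mulr_sumr -big_split -sumrB; apply: eq_bigr => k _ /=.
  rewrite !mulr_sumr -big_split -sumrB; apply: eq_bigr => l _ /=.
  by rewrite /half_sum /half_diff; field.
under eq_bigr do rewrite sum_delta.
under [X in _ + _ * X]eq_bigr do rewrite sum_delta.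
by rewrite !sum_delta (L_sym j i) -mulrDl -[RHS]mul1r; congr (_ * _); field.
Qed.

Lemma fine_charge_difference i j (A : set (measurableTypeR R)) : measurable A ->
  fine (W i j A) = fine (mu (half_sum i j) A) - fine (mu (half_diff i j) A).
Proof. by move=> mA; rewrite /W charge_differenceE fineB ?fin_num_measure. Qed.

(** The choice of the measures mu v involves no linearity in v; determinacy
    restores it, since both sides have the moments of the functional at v. *)
Lemma quadratic_form_measure v (A : set (measurableTypeR R)) : measurable A ->
  \sum_i \sum_j v i * v j * fine (W i j A) = fine (mu v A).
Proof.
move=> mA; pose I := (unit + (('I_N * 'I_N) + ('I_N * 'I_N)))%type.
pose m (x : I) := match x with
  | inl _ => mu v
  | inr (inl ij) => mu (half_sum ij.1 ij.2)
  | inr (inr ij) => mu (half_diff ij.1 ij.2) end.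
pose r (x : I) := match x with
  | inl _ => -1
  | inr (inl ij) => v ij.1 * v ij.2
  | inr (inr ij) => - (v ij.1 * v ij.2) end.
have sumI (F : {finite_measure set (measurableTypeR R) -> \bar R} -> R) :
    \sum_x r x * F (m x) = \sum_i \sum_j v i * v j *
      (F (mu (half_sum i j)) - F (mu (half_diff i j))) - F (mu v).
  rewrite !big_sumType /= (big_pred1 tt) => [|[]//].
  rewrite mulN1r addrC; congr (_ - _).
  rewrite -big_split /= pair_bigA; apply: eq_bigr => -[i j] _ /=.
  by rewrite mulNr mulrBr.
have m_I x : carried_by (m x) `[-1, 1] by case: x => [?|[?|?]]; exact: mu_I.
have m_moments (p : {poly R}) : \sum_x r x * \int[m x]_(x in `[-1, 1]) p.[x] = 0.
  rewrite (sumI (fun m => \int[m]_(x in `[-1, 1]) p.[x])).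
  under eq_bigr do under eq_bigr do rewrite !mu_moment polarization.
  by rewrite mu_moment subrr.
have := moment_determinacy m_I m_moments mA.
rewrite (sumI (fun m => fine (m A))) => /subr0_eq <-.
apply: eq_bigr => i _; apply: eq_bigr => j _.
by rewrite fine_charge_difference.
Qed.

(** W is symmetric because exchanging i and j changes the sign of half_diff,
    which leaves its quadratic functional unchanged. *)
Theorem matrix_moment_problem : exists W : matrix_measure R N,
  [/\ weight_matrix W, supported_on W `[-1, 1] &
    forall i j (p : {poly R}), charge_integral (W i j) `[-1, 1] (horner p) = L i j p].
Proof.
exists W; split.
- split=> [A mA|i j n]; last first.
    split.
      have := charge_pos_integrable (@mu_I (half_sum i j)) (@mu_I (half_diff i j)) 'X^n.
      by under [X in _.-integrable _ X]eq_fun do rewrite hornerXn.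
    have := charge_neg_integrable (@mu_I (half_sum i j)) (@mu_I (half_diff i j)) 'X^n.
    by under [X in _.-integrable _ X]eq_fun do rewrite hornerXn.
  split=> [|v].
    apply/matrixP => i j; rewrite !mxE !fine_charge_difference //.
    have -> : half_sum j i = half_sum i j.
      by apply/funext => k; rewrite /half_sum addrC.
    congr (_ - _); apply: moment_unique => // p; rewrite !mu_moment.
    apply: eq_bigr => k _; apply: eq_bigr => l _.
    by rewrite /half_diff; congr (_ * _); field.
  rewrite mxE; under eq_bigr do rewrite !mxE mulr_suml.
  rewrite exchange_big /=.
  have := quadratic_form_measure (fun i => v 0 i) mA.
  rewrite [X in X = _ -> _](_ : _ = \sum_j \sum_i v 0 j *
     matrix_measure_at W A j i * v 0 i).
    by move=> ->; exact: fine_ge0.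
  apply: eq_bigr => i _; apply: eq_bigr => j _; rewrite mxE.
  by rewrite mulrAC.
- move=> A mA AI; apply/matrixP => i j; rewrite !mxE /W charge_difference_null //.
  by apply/subsets_disjoint; rewrite setCK.
- by move=> i j p; rewrite charge_integral_difference // !mu_moment polarization.
Qed.

End matrix_moment_problem.


(** * The spider *)

Lemma matrix_integralE (R : realType) (N : nat) (W : matrix_measure R N)
    (L : 'I_N -> 'I_N -> {scalar {poly R}}) (F G : 'M[{poly R}]_N) i j :
  (forall k l (p : {poly R}), charge_integral (W k l) `[-1, 1] (horner p) = L k l p) ->
  matrix_integral W `[-1, 1] F G i j = \sum_k \sum_l L k l (F i k * G j l).
Proof.
move=> WL; rewrite mxE; apply: eq_bigr => k _; apply: eq_bigr => l _.
by rewrite -WL; congr charge_integral; apply/funext => x; rewrite hornerM.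
Qed.

Section spider.
Variables (R : realType) (N : nat) (alpha : nat -> R) (a b c : nat -> nat -> R).
Hypothesis params : spider_parameters N alpha a b c.

Let A n (i : 'I_N) : R := spider_A N alpha a n i i.
Let B n (i j : 'I_N) : R := spider_B N alpha b c n i j.
Let C n (i : 'I_N) : R := spider_C N c n i i.

(** The reversing measure of the chain, normalized to 1 at the body, at the
    state in row i of block n. Along each leg it is determined by detailed
    balance. *)
Fixpoint spider_weight (n : nat) (i : 'I_N) : R :=
  if n is n'.+1 then spider_weight n' i * A n' i / C n i
  else if i == 0%N :> nat then 1 else alpha i / c 1%N i.

Let alpha_gt0 m : (1 <= m <= N)%N -> 0 < alpha m.
Proof. by have [_ _ + _] := params; exact. Qed.

Let leg k m : (1 <= k)%N -> (1 <= m <= N)%N ->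
  [/\ a k m + b k m + c k m = 1, 0 < a k m, 0 <= b k m & 0 < c k m].
Proof. by have [_ _ _] := params; exact. Qed.

Let AE n i : A n i = if i == 0%N :> nat then (if n == 0%N then alpha N else a n N)
  else a n.+1 i.
Proof. by rewrite /A !mxE eqxx mulr1n. Qed.

Let CE n i : C n i = if i == 0%N :> nat then c n N else c n.+1 i.
Proof. by rewrite /C !mxE eqxx mulr1n. Qed.

Let BE0 i j : B 0 i j = if i == 0%N :> nat then alpha j
  else if j == 0%N :> nat then c 1%N i else if i == j then b 1%N i else 0.
Proof. by rewrite /B /spider_B !mxE. Qed.

Let BES n i j :
  B n.+1 i j = (if i == 0%N :> nat then b n.+1 N else b n.+2 i) *+ (i == j).
Proof. by rewrite /B /spider_B /= !mxE. Qed.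

Lemma spider_A_gt0 n i : 0 < A n i.
Proof.
have iN := ltn_ord i; rewrite AE; case: ifP => i0.
  case: ifP => n0; first by apply: alpha_gt0; lia.
  by have [] := @leg n N (ltac:(lia)) (ltac:(lia)).
by have [] := @leg n.+1 i (ltac:(lia)) (ltac:(lia)).
Qed.

Lemma spider_C_gt0 n i : 0 < C n.+1 i.
Proof.
have iN := ltn_ord i; rewrite CE; case: ifP => i0.
  by have [] := @leg n.+1 N (ltac:(lia)) (ltac:(lia)).
by have [] := @leg n.+2 i (ltac:(lia)) (ltac:(lia)).
Qed.

Lemma spider_B_ge0 n i j : 0 <= B n i j.
Proof.
have iN := ltn_ord i; have jN := ltn_ord j.
have [_ alpha0 _ _] := params.
case: n => [|n]; last first.
  rewrite BES mulrn_wge0 //; case: ifP => i0.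
    by have [] := @leg n.+1 N (ltac:(lia)) (ltac:(lia)).
  by have [] := @leg n.+2 i (ltac:(lia)) (ltac:(lia)).
rewrite BE0; case: ifP => i0.
  have [->//|j0] := posnP j; apply/ltW/alpha_gt0; lia.
have [_ _ b0 c0] := @leg 1 i isT (ltac:(lia)).
by case: ifP => _; [exact: ltW|case: ifP].
Qed.

Lemma spider_row_sum n i :
  A n i + \sum_j B n i j + (if n is 0 then 0 else C n i) = 1.
Proof.
have iN := ltn_ord i; have [alpha1 _ _ _] := params.
case: n => [|n].
  rewrite addr0 AE; under eq_bigr do rewrite BE0.
  case: ifP => i0.
    by rewrite addrC -alpha1 big_nat_recr //= big_mkord.
  pose z : 'I_N := Ordinal (leq_ltn_trans (leq0n i) iN).
  rewrite (bigD1 z) //= (bigD1 i) /=; last by rewrite -val_eqE /= i0.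
  rewrite i0 eqxx big1 ?addr0 => [|j /andP[jz ji]]; last first.
    by rewrite -val_eqE /= in jz; rewrite (negbTE jz) eq_sym (negbTE ji).
  have [<- _ _ _] := @leg 1 i isT (ltac:(lia)).
  by rewrite addrA addrAC.
rewrite AE CE; under eq_bigr do rewrite BES.
rewrite (bigD1 i) //= eqxx mulr1n big1 ?addr0 => [|j]; last first.
  by rewrite eq_sym => /negbTE ->; rewrite mulr0n.
case: ifP => i0.
  by have [] := @leg n.+1 N (ltac:(lia)) (ltac:(lia)).
by have [] := @leg n.+2 i (ltac:(lia)) (ltac:(lia)).
Qed.

Lemma spider_weight_gt0 n i : 0 < spider_weight n i.
Proof.
elim: n => [|n IH] /=.
  case: ifP => // i0; have iN := ltn_ord i.
  have [_ _ _ c0] := @leg 1 i isT (ltac:(lia)).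
  by rewrite divr_gt0 // alpha_gt0 //; lia.
by rewrite divr_gt0 ?mulr_gt0 ?spider_A_gt0 ?spider_C_gt0.
Qed.

Lemma spider_balance_AC n i :
  spider_weight n i * A n i = spider_weight n.+1 i * C n.+1 i.
Proof. by rewrite /= divfK // gt_eqF // spider_C_gt0. Qed.

Lemma spider_balance_B n i j :
  spider_weight n i * B n i j = spider_weight n j * B n j i.
Proof.
have [->//|ij] := eqVneq i j.
case: n => [|n]; last first.
  by rewrite !BES [j == i]eq_sym (negbTE ij) !mulr0n !mulr0.
have c_neq0 (k : 'I_N) : k != 0%N :> nat -> c 1 k != 0.
  move=> k0; have kN := ltn_ord k.
  by have [_ _ _ /gt_eqF ->] := @leg 1 k isT (ltac:(lia)).
rewrite !BE0 /= [j == i]eq_sym (negbTE ij).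
case: ifP => i0; case: ifP => j0.
- by case/eqP: ij; apply/val_inj; rewrite /= (eqP i0) (eqP j0).
- by rewrite mul1r divfK // c_neq0 // j0.
- by rewrite mul1r divfK // c_neq0 // i0.
- by rewrite !mulr0.
Qed.

Variable Q : nat -> 'M[{poly R}]_N.
Hypothesis polys : matrix_polynomials
  (spider_A N alpha a) (spider_B N alpha b c) (spider_C N c) Q.

Lemma spider_recurrence n i k : 'X * Q n i k =
  A n i *: Q n.+1 i k + \sum_j B n i j *: Q n j k
  + (if n is n'.+1 then C n i *: Q n' i k else 0).
Proof.
have diagM (d : 'rV[R]_N) (M : 'M[{poly R}]_N) :
    (map_mx polyC (diag_mx d) *m M) i k = diag_mx d i i *: M i k.
  rewrite mxE (bigD1 i) //= big1 ?addr0 => [|j ji].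
    by rewrite !mxE mul_polyC.
  by rewrite !mxE eq_sym (negbTE ji) mulr0n polyC0 mul0r.
have [_ /(_ n)] := polys; move=> /matrixP /(_ i k).
rewrite mxE => ->; rewrite [LHS]mxE [X in X + _]mxE.
congr (_ + _ + _).
  exact: diagM.
  by rewrite mxE; apply: eq_bigr => j _; rewrite mxE mul_polyC.
by case: n => [|n]; [rewrite mxE|exact: diagM].
Qed.

Lemma spider_initial i k : Q 0 i k = (i == k)%:R.
Proof. by have [-> _] := polys; rewrite mxE. Qed.

End spider.

Theorem proposition2p1 (R : realType) (N : nat) (N_gt0 : (0 < N)%N)
    (alpha : nat -> R) (a b c : nat -> nat -> R)
    (params : spider_parameters N alpha a b c)
    (d : measure_display) (T : measurableType d) (Pr : probability T R)
    (S : nat -> T -> spider N)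
    (chain : homogeneous_markov_chain Pr S (spider_transition alpha a b c))
    (Q : nat -> 'M[{poly R}]_N)
    (polys : matrix_polynomials
       (spider_A N alpha a) (spider_B N alpha b c) (spider_C N c) Q) :
  exists W : matrix_measure R N,
    [/\ weight_matrix W,
        supported_on W `[-1, 1],
        forall n m : nat,
          matrix_integral W `[-1, 1] (Q n) (Q m) =
          if n == m then matrix_norm2 W (Q n) else 0 &
        forall n : nat, matrix_norm2 W (Q n) \in unitmx].
Proof.
pose A n (i : 'I_N) : R := spider_A N alpha a n i i.
pose B n (i j : 'I_N) : R := spider_B N alpha b c n i j.
pose C n (i : 'I_N) : R := spider_C N c n i i.
pose w : nat -> 'I_N -> R := spider_weight alpha a c.
have w_gt0 n i : 0 < w n i by exact: spider_weight_gt0 params n i.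
have A_gt0 n i : 0 < A n i by exact: spider_A_gt0 params n i.
have B_ge0 n i j : 0 <= B n i j by exact: spider_B_ge0 params n i j.
have row n i : A n i + \sum_j B n i j + (if n is 0 then 0 else C n i) <= 1.
  by rewrite [leLHS](spider_row_sum params n i).
have bAC n i : w n i * A n i = w n.+1 i * C n.+1 i.
  exact: spider_balance_AC params n i.
have bB n i j : w n i * B n i j = w n j * B n j i.
  exact: spider_balance_B params n i j.
pose L (k l : 'I_N) : {scalar {poly R}} := coef_functional (moment A C B w k l).
have L_sym k l p : L k l p = L l k p.
  exact: (moment_functional_sym w_gt0 bAC bB).
have L_contraction (F : 'I_N -> {poly R}) :
    `|\sum_k \sum_l L k l ('X * (F k * F l))| <= \sum_k \sum_l L k l (F k * F l).
  exact: (moment_functional_contraction w_gt0 A_gt0 B_ge0 row bAC bB).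
have L_squares v p : `|quadratic_functional L v ('X * (p * p))| <=
    quadratic_functional L v (p * p).
  have := L_contraction (fun k => v k *: p).
  have scaled (r : {poly R}) k l :
      L k l (r * (v k *: p * (v l *: p))) = v k * v l * L k l (r * (p * p)).
    by rewrite -scalerAl -!scalerAr scalerA linearZ.
  under eq_bigr do under eq_bigr do rewrite scaled.
  rewrite /quadratic_functional => /le_trans; apply.
  rewrite le_eqVlt; apply/orP; left; apply/eqP.
  apply: eq_bigr => k _; apply: eq_bigr => l _.
  by have := scaled 1 k l; rewrite !mul1r.
have L_ge0 v k l : 0 <= quadratic_functional L v ((1 + 'X) ^+ k * (1 - 'X) ^+ l).
  apply: functional_ge0_of_squares => p; have := L_squares v p; rewrite ler_norml.
    rewrite mulrDr mulr1 [_ * 'X]mulrC linearD /= => /andP[? _].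
    by rewrite addrC -lerBlDr sub0r.
  rewrite mulrBr mulr1 [_ * 'X]mulrC linearB /= => /andP[_ ?].
  by rewrite subr_ge0.
have [W [W_weight W_supp WL]] := matrix_moment_problem L_sym L_ge0.
have WQ n m i j : matrix_integral W `[-1, 1] (Q n) (Q m) i j =
    ((n == m) && (i == j))%:R / w n i.
  rewrite (matrix_integralE _ _ _ _ WL).
  exact: (moment_orthogonality w_gt0 A_gt0 bAC bB (spider_initial polys)
    (spider_recurrence polys)).
exists W; split=> // [n m|n].
  apply/matrixP => i j; case: eqP => [->//|/eqP/negbTE nm].
  by rewrite WQ nm mul0r mxE.
have -> : matrix_norm2 W (Q n) = diag_mx (\row_i (w n i)^-1).
  apply/matrixP => i j; rewrite WQ eqxx !mxE /=.
  by case: eqP => _; rewrite ?mul1r ?mul0r ?mulr1n ?mulr0n.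
rewrite unitmxE det_diag unitfE; apply/prodf_neq0 => i _.
by rewrite mxE invr_eq0 gt_eqF.
Qed.
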